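(* The single-variable optimization problem $$\text{NCR:}\quad \max\Big\{\sum_{j\in N}c_jx_j(\delta):\ \delta\in\mathbb{R}_+\Big\}$$ can be solved (to optimality) in $O(n^3\log n)$ time.
   Context: Let $N=\{1,\dots,n\}$ be a set of items. Each $j\in N$ has a profit $c_j>0$, a mean weight $a_j>0$ and a standard deviation $\sigma_j\ge 0$; the capacity is $b>0$; $\rho\in[0.5,1)$; and $\Phi^{-1}$ is the inverse of the standard normal cumulative distribution function. Standing assumptions: $\sum_{j\in N}a_j+\Phi^{-1}(\rho)\sqrt{\sum_{j\in N}\sigma_j^2}>b$, and $a_j+\Phi^{-1}(\rho)\sigma_j\le b$ for each $j\in N$. NCR is a reformulation of the non-convex relaxation $\max\{\sum_{j\in N}c_jx_j: x\in[0,1]^n,\ g(x)\le b\}$, where $g(x)=\sum_{j\in N}a_jx_j+\Phi^{-1}(\rho)\sqrt{\sum_{j\in N}\sigma_j^2x_j}$. Orderings $\tau(\delta)$: let $\bar N=\{j\in N:\sigma_j=0\}$. For $j\in N$ and $\delta\ge 0$ let $a_j(0)=a_j$, $a_j(\delta)=a_j+\frac{\Phi^{-1}(\rho)}{2\sqrt\delta}\sigma_j^2$ for $\delta>0$, and $p_j(\delta)=c_j/a_j(\delta)$. For $\delta>0$, $\tau(\delta)$ is the sequence of all elements of $N$ sorted in descending order of $p_j(\delta)$. For $\delta=0$, $\tau(0)$ lists first the elements of $\bar N$ in descending order of $p_j(0)$, then the elements of $N\setminus\bar N$ in descending order of $p_j(0)$. Ties are resolved in descending order of $\sigma_j^2/c_j$,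 and remaining ties in ascending order of index. Greedy points $x(\delta)$: for $\delta\ge 0$ write $\tau(\delta)=(\tau_1,\dots,\tau_n)$ and let $t=\min\{k\in N:\sum_{j=1}^k a_{\tau_j}+\Phi^{-1}(\rho)\sqrt{\sum_{j=1}^k\sigma_{\tau_j}^2}\ge b\}$ (it exists by the standing assumption). Let $\theta^\star$ be the smaller of the two solutions $\theta\in\mathbb R$ of $\Phi^{-1}(\rho)^2\big(\sum_{j=1}^{t-1}\sigma_{\tau_j}^2+\sigma_{\tau_t}^2\theta\big)=\big(b-\sum_{j=1}^{t-1}a_{\tau_j}-a_{\tau_t}\theta\big)^2$; then $0<\theta^\star\le1$. Define $x_{\tau_j}(\delta)=1$ for $j<t$, $x_{\tau_t}(\delta)=\theta^\star$, and $x_{\tau_j}(\delta)=0$ for $j>t$. Running time counts elementary operations on real numbers (arithmetic operations, comparisons, square roots), with $\Phi^{-1}(\rho)$ given. *)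

(* Defs.v *)
From HB Require Import structures.
From mathcomp Require Import all_boot all_order all_algebra.
From mathcomp Require Import all_classical all_reals all_analysis.
Set Implicit Arguments.
Unset Strict Implicit.
Unset Printing Implicit Defensive.
Import Order.TTheory GRing.Theory Num.Theory.
Local Open Scope classical_set_scope.
Local Open Scope ring_scope.

Section StandardNormal.
Variable R : realType.

Definition normal_cdf (x : R) : R := fine (normal_prob 0 1 `]-oo, x]).

(* [normal_cdf] is a strictly increasing bijection from R onto ]0, 1[, so for
   rho in ]0, 1[ the point chosen by [xget] is the unique one. *)
Definition normal_quantile (rho : R) : R := xget 0 [set x : R | normal_cdf x = rho].

End StandardNormal.

(* The item set is 'I_n, i.e. items are numbered from 0. *)
Record knapsack (R : realType) (n : nat) := Knapsack {
  profit : 'I_n -> R;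
  weight : 'I_n -> R;
  stdev : 'I_n -> R;
  capacity : R;
  rho : R }.

Section NCR.
Variables (R : realType) (n : nat) (I : knapsack R n).

Local Notation c := (profit I).
Local Notation a := (weight I).
Local Notation sigma := (stdev I).
Local Notation b := (capacity I).

Definition safety : R := normal_quantile (rho I).
Local Notation q := safety.

(* Left-hand side of the capacity constraint when exactly the items of the
   duplicate-free sequence [s] are packed. *)
Definition load (s : seq 'I_n) : R :=
  \sum_(j <- s) a j + q * Num.sqrt (\sum_(j <- s) sigma j ^+ 2).

Definition well_posed : Prop :=
  [/\ forall j, 0 < c j, forall j, 0 < a j & forall j, 0 <= sigma j] /\
  [/\ 0 < b, 2^-1 <= rho I < 1, b < load (enum 'I_n) &
      forall j, a j + q * sigma j <= b].

Definition mod_weight (d : R) (j : 'I_n) : R :=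
  if d == 0 then a j else a j + q / (2 * Num.sqrt d) * sigma j ^+ 2.

Definition density (d : R) (j : 'I_n) : R := c j / mod_weight d j.

(* [precedes d i j]: i is listed before j, or i = j.  The comparison is
   lexicographic; its first component is only active for d = 0. *)
Definition precedes (d : R) (i j : 'I_n) : bool :=
  let ri := sigma i ^+ 2 / c i in
  let rj := sigma j ^+ 2 / c j in
  if (d == 0) && ((sigma i == 0) != (sigma j == 0)) then sigma i == 0
  else if density d i != density d j then density d j < density d i
  else if ri != rj then rj < ri
  else (i <= j)%N.

Definition tau (d : R) : seq 'I_n := sort (precedes d) (enum 'I_n).

(* Number of items packed entirely, i.e. t - 1 for the critical position t,
   which is counted from 1. *)
Definition nb_full (d : R) : nat :=
  find (fun k => b <= load (take k.+1 (tau d))) (iota 0 n).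

Definition crit_eq (s : seq 'I_n) (k : 'I_n) (theta : R) : Prop :=
  q ^+ 2 * (\sum_(j <- s) sigma j ^+ 2 + sigma k ^+ 2 * theta) =
  (b - \sum_(j <- s) a j - a k * theta) ^+ 2.

(* The smaller root, and the only root if it is double. *)
Definition crit_fraction (s : seq 'I_n) (k : 'I_n) : R :=
  xget 0 [set theta : R | crit_eq s k theta /\
     forall theta', crit_eq s k theta' -> theta <= theta'].

Definition greedy_point (d : R) (j : 'I_n) : R :=
  let m := nb_full d in
  if (index j (tau d) < m)%N then 1
  else if index j (tau d) == m then crit_fraction (take m (tau d)) j
  else 0.

Definition ncr_value (d : R) : R := \sum_j c j * greedy_point d j.

Definition ncr_optimal (d : R) : Prop :=
  0 <= d /\ forall d', 0 <= d' -> ncr_value d' <= ncr_value d.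

End NCR.

(* A real RAM.  A program is a finite text that does not depend on the input;
   it works on finitely many unbounded arrays of natural numbers (used for
   indexing and loop control) and of reals, all named by constants.  An array
   cell is addressed by an index expression, and scalars are one-cell arrays.
   There is no conversion between index values and real values. *)
Inductive iexp : Type :=
| IConst of nat
| ILoad of nat & iexp
| IAdd of iexp & iexp
| ISub of iexp & iexp.

Inductive rexp : Type :=
| RConst of nat
| RLoad of nat & iexp
| RAdd of rexp & rexp
| RSub of rexp & rexp
| RMul of rexp & rexp
| RDiv of rexp & rexp
| RSqrt of rexp.

Inductive bexp : Type :=
| BLei of iexp & iexp
| BLer of rexp & rexp
| BNot of bexp
| BAnd of bexp & bexp.

Inductive cmd : Type :=
| Skip
| IStore of nat & iexp & iexp
| RStore of nat & iexp & rexp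
| Seq of cmd & cmd
| If of bexp & cmd & cmd
| While of bexp & cmd.

(* Every constant, memory access, arithmetic operation, comparison and boolean
   connective of an expression costs one unit. *)
Fixpoint icost (e : iexp) : nat :=
  match e with
  | IConst _ => 1
  | ILoad _ e1 => (icost e1).+1
  | IAdd e1 e2 | ISub e1 e2 => (icost e1 + icost e2).+1
  end%N.

Fixpoint rcost (e : rexp) : nat :=
  match e with
  | RConst _ => 1
  | RLoad _ e1 => (icost e1).+1
  | RAdd e1 e2 | RSub e1 e2 | RMul e1 e2 | RDiv e1 e2 =>
      (rcost e1 + rcost e2).+1
  | RSqrt e1 => (rcost e1).+1
  end%N.

Fixpoint bcost (e : bexp) : nat :=
  match e with
  | BLei e1 e2 => (icost e1 + icost e2).+1
  | BLer e1 e2 => (rcost e1 + rcost e2).+1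
  | BNot e1 => (bcost e1).+1
  | BAnd e1 e2 => (bcost e1 + bcost e2).+1
  end%N.

Record state (R : realType) := State {
  imem : nat -> nat -> nat;
  rmem : nat -> nat -> R }.

Definition upd (T : Type) (m : nat -> nat -> T) (k i : nat) (v : T) :
    nat -> nat -> T :=
  fun k' i' => if (k' == k) && (i' == i) then v else m k' i'.

Section Semantics.
Variable R : realType.
Implicit Types (st : state R).

(* Subtraction of index values is truncated at 0. *)
Fixpoint ieval st (e : iexp) : nat :=
  match e with
  | IConst k => k
  | ILoad k e1 => imem st k (ieval st e1)
  | IAdd e1 e2 => ieval st e1 + ieval st e2
  | ISub e1 e2 => ieval st e1 - ieval st e2
  end%N.

(* Operations are total, with the conventions x / 0 = 0 and sqrt x = 0 for
   x < 0; guarding them by a comparison would cost a constant factor. *)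
Fixpoint reval st (e : rexp) : R :=
  match e with
  | RConst k => k%:R
  | RLoad k e1 => rmem st k (ieval st e1)
  | RAdd e1 e2 => reval st e1 + reval st e2
  | RSub e1 e2 => reval st e1 - reval st e2
  | RMul e1 e2 => reval st e1 * reval st e2
  | RDiv e1 e2 => reval st e1 / reval st e2
  | RSqrt e1 => Num.sqrt (reval st e1)
  end.

Fixpoint beval st (e : bexp) : bool :=
  match e with
  | BLei e1 e2 => (ieval st e1 <= ieval st e2)%N
  | BLer e1 e2 => reval st e1 <= reval st e2
  | BNot e1 => ~~ beval st e1
  | BAnd e1 e2 => beval st e1 && beval st e2
  end.

(* [exec p st st' t]: started in [st], the program [p] halts in [st'] after
   exactly [t] elementary operations. *)
Inductive exec : cmd -> state R -> state R -> nat -> Prop :=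
| ExecSkip st : exec Skip st st 0
| ExecIStore st k e v :
    exec (IStore k e v) st
      (State (upd (imem st) k (ieval st e) (ieval st v)) (rmem st))
      (icost e + icost v).+1
| ExecRStore st k e v :
    exec (RStore k e v) st
      (State (imem st) (upd (rmem st) k (ieval st e) (reval st v)))
      (icost e + rcost v).+1
| ExecSeq st1 st2 st3 p1 p2 t1 t2 :
    exec p1 st1 st2 t1 -> exec p2 st2 st3 t2 ->
    exec (Seq p1 p2) st1 st3 (t1 + t2)
| ExecIf st st' e p1 p2 t :
    exec (if beval st e then p1 else p2) st st' t ->
    exec (If e p1 p2) st st' (bcost e + t).+1
| ExecWhileEnd st e p :
    ~~ beval st e -> exec (While e p) st st (bcost e).+1
| ExecWhileLoop st1 st2 st3 e p t1 t2 :
    beval st1 e -> exec p st1 st2 t1 -> exec (While e p) st2 st3 t2 ->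
    exec (While e p) st1 st3 (bcost e + t1 + t2).+1.

Lemma exec_det p st st1 st2 t1 t2 :
  exec p st st1 t1 -> exec p st st2 t2 -> st1 = st2 /\ t1 = t2.
Proof.
move=> E1; elim: E1 st2 t2 => {p st st1 t1}
  [st|st k e v|st k e v|s1 s2 s3 p1 p2 t1 t2 _ IH1 _ IH2|
   st st' e p1 p2 t _ IH|st e p Ne|s1 s2 s3 e p t1 t2 He _ IH1 _ IH2] u u' E.
- by inversion E.
- by inversion E.
- by inversion E.
- inversion E; subst.
  have [? ?] := IH1 _ _ ltac:(eassumption); subst.
  by have [? ?] := IH2 _ _ ltac:(eassumption); subst.
- inversion E; subst.
  by have [? ?] := IH _ _ ltac:(eassumption); subst.
- inversion E; subst=> //.
  by move: Ne => /negP[].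
- inversion E; subst; first by case/negP: (ltac:(eassumption) : is_true (~~ _)).
  have [? ?] := IH1 _ _ ltac:(eassumption); subst.
  by have [? ?] := IH2 _ _ ltac:(eassumption); subst.
Qed.

(* Input: n in index array 0; c, a, sigma in real arrays 0, 1, 2; b and
   Phi^-1(rho) in cells 0 and 1 of real array 3; everything else is 0. *)
Definition input_state (n : nat) (I : knapsack R n) : state R :=
  let vec (f : 'I_n -> R) (i : nat) : R := oapp f 0 (insub i) in
  State
    (fun k i => if (k == 0%N) && (i == 0%N) then n else 0%N)
    (fun k i =>
       match k, i with
       | 0%N, _ => vec (profit I) i
       | 1%N, _ => vec (weight I) i
       | 2%N, _ => vec (stdev I) i
       | 3%N, 0%N => capacity I
       | 3%N, 1%N => safety I
       | _, _ => 0
       end).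

(* Output: the computed point and its objective value, in cells 0 and 1 of
   real array 4. *)
Definition out_point st : R := rmem st 4 0.
Definition out_value st : R := rmem st 4 1.

End Semantics.

(* Main.v *)
From HB Require Import structures.
Require Import Defs.
From mathcomp Require Import all_boot all_order all_algebra.
From mathcomp Require Import all_classical all_reals all_analysis.
From mathcomp Require Import measurable_realfun ring lra zify.
Set Implicit Arguments.
Unset Strict Implicit.
Unset Printing Implicit Defensive.
Import Order.TTheory GRing.Theory Num.Theory numFieldNormedType.Exports.
Local Open Scope classical_set_scope.
Local Open Scope ring_scope.

(** The value of a greedy point depends on d only through the ordering tau(d).
For d > 0 and m = sqrt d, the reciprocal density of an item is affine in 1 / m,
so comparing the densities of items i and j amounts to the sign of a function
that is affine in m ([gap]).  Hence each pair of items exchanges places at most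
once, at [swap_point], and the at most n^2 swap points cut ]0, +oo[ into
intervals on which tau is constant.  The tie-breaking rule (larger sigma^2 / c
first) gives at a swap point the ordering that holds just to its right, because
q = Phi^-1(rho) is nonnegative; so these intervals contain their left end
([prec_const]).  It is therefore enough to try d = 0, every swap point, and one
point below all positive swap points ([candidates_optimal]).  The point d = 0
has to be tried separately: tau(0) need not be the limit of tau(d) as d goes to 0.

For one d, the items are sorted by a bottom-up merge sort in O(n log n), and a
linear scan locates the critical item, whose fraction is the smaller root of an
explicit quadratic equation ([ncr_valueE], [evaluate_spec]).  Doing this for
n^2 + 2 values of d takes O(n^3 log n) operations ([search_cost_dominated]).
Well-posedness forces n >= 2, so that ln n is bounded away from 0
([well_posed_size]).

The programs are verified with total-correctness triples that carry a time
bound ([runs]); what a program leaves unchanged is read off its syntax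
([exec_framed]). *)

(** * The safety factor is nonnegative *)

Section Quantile.
Variable R : realType.
Let P := @normal_prob R 0 1.

Lemma normal_prob_reflect (x : R) : P `]-oo, x] = P `[- x, +oo[.
Proof.
rewrite /P /normal_prob -{1}(opprK x) ge0_integration_by_substitutionNy.
- apply: eq_integral => y _; congr EFin.
  by rewrite /= !normal_pdfE ?oner_neq0//= /normal_fun !subr0 sqrrN.
- by apply: continuous_subspaceT; apply: continuous_normal_pdf; rewrite oner_neq0.
- by move=> y _; exact: normal_pdf_ge0.
Qed.

Lemma normal_prob_centered_gt0 (x : R) : 0 < x -> (0 < P `](- x)%R, x[)%E.
Proof.
move=> x0.
have pdf_ge y : y \in `]- x, x[ -> normal_pdf 0 1 x <= normal_pdf 0 1 y.
  rewrite in_itv/= => /andP[xy yx].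
  rewrite !normal_pdfE ?oner_neq0//= ler_wpM2l ?normal_peak_ge0//.
  rewrite /normal_fun !subr0 ler_expR !mulNr lerN2 ler_wpM2r//.
  by rewrite -ler_sqrt ?sqr_ge0// !sqrtr_sqr (gtr0_norm x0) ler_norml !ltW.
apply: (@lt_le_trans _ _ (\int[lebesgue_measure]_(y in `](- x)%R, x[) (normal_pdf 0 1 x)%:E)%E).
  rewrite integral_cst//= lebesgue_measure_itv/= lte_fin gtrN// -EFinD -EFinM lte_fin.
  apply: mulr_gt0; last by rewrite opprK addr_gt0.
  by rewrite normal_pdfE ?oner_neq0//= mulr_gt0 ?expR_gt0 ?normal_peak_gt0 ?oner_neq0.
apply: ge0_le_integral => //=.
- by move=> y _; rewrite lee_fin normal_pdf_ge0.
- by apply/measurable_EFinP; apply: measurable_funTS; exact: measurable_normal_pdf.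
Qed.

(** By symmetry the two tails beyond |x| have equal mass, and the open interval
between them has positive mass because the density is bounded below there. *)
Lemma normal_cdf_lt_half (x : R) : x < 0 -> normal_cdf x < 2^-1.
Proof.
move=> x0.
have fP (i : interval R) : P [set` i] \is a fin_num by exact: fin_num_measure.
have lo : 0 < fine (P `]x, (- x)%R[).
  rewrite -lte_fin (fineK (fP _)); have := @normal_prob_centered_gt0 (- x).
  by rewrite oppr_gt0 opprK; apply.
pose L := [set` `]-oo, x]]; pose M := [set` `]x, - x[]; pose U := [set` `[- x, +oo[].
have mI (i : interval R) : measurable [set` i] by exact: measurable_itv.
have: (P L + (P M + P U) = 1)%E.
  have MU : M `&` U = set0.
    apply/seteqP; split=> y //=; rewrite /M/U/= !in_itv/= andbT => -[/andP[_ yx] yN].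
    by have := le_lt_trans yN yx; rewrite ltxx.
  have LMU : L `&` (M `|` U) = set0.
    apply/seteqP; split=> y //=; rewrite /L/M/U/= !in_itv/= andbT => -[yx [/andP[xy _]|yN]].
      by have := le_lt_trans yx xy; rewrite ltxx.
    by have := le_trans yN yx; lra.
  rewrite -measureU ?MU//; try exact: mI.
  rewrite -measureU ?LMU//; try exact: mI; last by apply: measurableU; exact: mI.
  rewrite -(@probability_setT _ _ _ P); congr (P _).
  apply/seteqP; split=> y //= _; rewrite /L/M/U/= !in_itv/= andbT.
  by case: (leP y x) => yx; [left|right; case: (ltP y (- x)) => yNx; [left|right]].
rewrite /U -normal_prob_reflect.
rewrite /normal_cdf -/(P L); move: (fP `]-oo, x]) (fP `]x, - x[) lo.
rewrite -/L -/M; move: (P L) (P M) => [l| |]// [m| |]// _ _ /= m0 [sum1]; lra.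
Qed.

(** A negative quantile would have cumulative probability below 1/2; and if no
point has cumulative probability rho, [normal_quantile] is 0 by default. *)
Lemma safety_ge0 n (I : knapsack R n) : 2^-1 <= rho I -> 0 <= safety I.
Proof.
move=> rhoI; rewrite /safety /normal_quantile.
case: (xgetP 0 [set x : R | normal_cdf x = rho I]) => [y _ /= yE|//].
rewrite leNgt; apply/negP => /normal_cdf_lt_half.
by rewrite yE ltNge rhoI.
Qed.
End Quantile.

(** * Comparing items: orderings change only at swap points *)

Section KeyLex.
Variables (R : realType) (T : Type).

(** Descending order of the key [f], ties passed on to [k].  Two strict
comparisons avoid an equality test on reals, which the machine does not offer. *)
Definition keylex (f : T -> R) (k : rel T) : rel T :=
  fun i j => (f j < f i) || ~~ (f i < f j) && k i j.

Lemma keylex_total f k : total k -> total (keylex f k).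
Proof. by move=> kT i j; rewrite /keylex; case: (ltgtP (f i) (f j)) => //= _; exact: kT. Qed.

Lemma keylex_trans f k : transitive k -> transitive (keylex f k).
Proof.
move=> kT j i l; rewrite /keylex.
case: (ltgtP (f i) (f j)) => //= [ji _|ij kij].
  by case: (ltgtP (f j) (f l)) => //= [lj _|<-]; rewrite ?(lt_trans lj ji) ?ji.
by rewrite ij; case: (ltgtP (f j) (f l)) => //= _; exact: kT.
Qed.

Lemma keylex_anti f k : antisymmetric k -> antisymmetric (keylex f k).
Proof.
move=> kA i j; rewrite /keylex.
by case: (ltgtP (f i) (f j)) => //= _; exact: kA.
Qed.

End KeyLex.

Section Order.
Variables (R : realType) (c a sg : nat -> R) (q : R).

(** At d = 0 the second term vanishes, as division by 0 yields 0; so this is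
[mod_weight] for every d >= 0. *)
Definition wt (d : R) (i : nat) : R := a i + q / (2 * Num.sqrt d) * sg i ^+ 2.
Definition dens (d : R) (i : nat) : R := c i / wt d i.
Definition risk_ratio (i : nat) : R := sg i ^+ 2 / c i.
(** The first sorting criterion at d = 0; constant for d > 0.  It is a real so
that it can serve as a key of [keylex]. *)
Definition riskless (d : R) (i : nat) : R := ((d <= 0) && (sg i <= 0))%:R.

Definition prec (d : R) : rel nat :=
  keylex (riskless d) (keylex (dens d) (keylex risk_ratio leq)).

Lemma prec_total d : total (prec d).
Proof. by do 3!apply: keylex_total; exact: leq_total. Qed.

Lemma prec_trans d : transitive (prec d).
Proof. by do 3!apply: keylex_trans; exact: leq_trans. Qed.

Lemma prec_anti d : antisymmetric (prec d).
Proof. by do 3!apply: keylex_anti; exact: anti_leq. Qed.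

(** The square of the zero of [gap].  When that zero is negative or the
denominator vanishes, this is just some nonnegative number; trying it does no
harm. *)
Definition swap_point (i j : nat) : R :=
  (q * (c j * sg i ^+ 2 - c i * sg j ^+ 2) / (2 * (c i * a j - c j * a i))) ^+ 2.

(** For m = sqrt d this has the sign of [dens d i - dens d j], and it is affine
in m: the difference of the densities with its denominators cleared. *)
Definition gap (m : R) (i j : nat) : R :=
  2 * m * (c i * a j - c j * a i) - q * (c j * sg i ^+ 2 - c i * sg j ^+ 2).

Lemma gapC m i j : gap m j i = - gap m i j. Proof. by rewrite /gap; ring. Qed.

Lemma lt_dens d i j : 0 < d -> 0 <= q -> 0 < c i -> 0 < c j -> 0 < a i -> 0 < a j ->
  (dens d j < dens d i) = (0 < gap (Num.sqrt d) i j).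
Proof.
move=> d0 q0 ci cj ai aj; have m0 : 0 < Num.sqrt d by rewrite sqrtr_gt0.
have wt0 k : 0 < a k -> 0 < wt d k.
  move=> ak; apply: ltr_wpDr ak; rewrite mulr_ge0 ?sqr_ge0// divr_ge0// mulr_ge0//.
rewrite /dens ltr_pdivrMr ?wt0// mulrAC ltr_pdivlMr ?wt0//.
rewrite -subr_gt0 -[LHS](pmulr_rgt0 _ (mulr_gt0 (ltr0Sn R 1) m0)); congr (0 < _).
by rewrite /wt /gap; field; rewrite gt_eqF.
Qed.

Lemma lt_risk_ratio i j : 0 < c i -> 0 < c j ->
  (risk_ratio j < risk_ratio i) = (0 < c j * sg i ^+ 2 - c i * sg j ^+ 2).
Proof.
move=> ci cj; rewrite /risk_ratio ltr_pdivrMr// mulrAC ltr_pdivlMr//.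
by rewrite subr_gt0 mulrC [c j * _]mulrC.
Qed.

(** If X = 0 the gap is constant.  Otherwise its zero r is either below m1, so
that the gap has the sign of X at both points, or above m2, where it has the
sign of - X at both, or equal to m1.  In the last case the densities tie at m1
and the tie-break looks at the sign of Z; there q Z = 2 m1 X, so it is the sign
of X, which is the sign of the gap at m2. *)
Lemma prec_const d1 d2 i j :
  0 <= q -> 0 < c i -> 0 < c j -> 0 < a i -> 0 < a j ->
  0 < d1 <= d2 -> ~~ (d1 < swap_point i j <= d2) ->
  prec d1 i j = prec d2 i j.
Proof.
move=> q0 ci cj ai aj /andP[d10 d12] noswap.
have d20 : 0 < d2 by exact: lt_le_trans d12.
rewrite /prec /keylex /riskless !(leNgt _ 0) d10 d20 /= ltxx /=.
rewrite !lt_dens// !lt_risk_ratio// !(gapC _ i j).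
move: noswap; rewrite /gap /swap_point.
set X := c i * a j - c j * a i; set Z := c j * sg i ^+ 2 - c i * sg j ^+ 2.
have -> : c i * sg j ^+ 2 - c j * sg i ^+ 2 = - Z by rewrite /Z opprB.
rewrite !oppr_gt0.
have m10 : 0 < Num.sqrt d1 by rewrite sqrtr_gt0.
have m12 : Num.sqrt d1 <= Num.sqrt d2 by exact: ler_wsqrtr.
rewrite -{1}(sqr_sqrtr (ltW d10)) -{1}(sqr_sqrtr (ltW d20)).
move: (Num.sqrt d1) (Num.sqrt d2) m10 m12 => {d10 d12 d20 d1 d2} m1 m2 m10 m12.
have [->|X0] := eqVneq X 0; first by rewrite !mulr0.
set r := q * Z / (2 * X) => noswap.
have qZ : q * Z = 2 * r * X by rewrite /r; field.
have gapE m : 2 * m * X - q * Z = 2 * (m - r) * X by rewrite qZ; ring.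
rewrite !gapE.
have sgap m : (0 < 2 * (m - r) * X) = (0 < (m - r) * X).
  by rewrite -mulrA pmulr_rgt0.
have sgap' m : (2 * (m - r) * X < 0) = ((m - r) * X < 0).
  by rewrite -mulrA pmulr_rlt0.
rewrite !sgap !sgap'.
have [rm1|m1r|rm1] := ltgtP r m1.
- have ? : 0 < m1 - r by rewrite subr_gt0.
  have ? : 0 < m2 - r by rewrite subr_gt0 (lt_le_trans rm1).
  by rewrite !pmulr_rgt0 ?pmulr_rlt0.
- have m2r : m2 < r.
    have r0 : 0 < r by exact: lt_trans m1r.
    rewrite ltNge; apply: contra noswap => rm2.
    have m20 : 0 < m2 by exact: lt_le_trans m12.
    apply/andP; split; first by rewrite ltr_pXn2r ?nnegrE ?(ltW m10) ?(ltW r0).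
    by rewrite ler_pXn2r ?nnegrE ?(ltW m20) ?(ltW r0).
  have ? : m1 - r < 0 by rewrite subr_lt0.
  have ? : m2 - r < 0 by rewrite subr_lt0.
  by rewrite !nmulr_rgt0 ?nmulr_rlt0.
- move: m12; rewrite rm1 subrr mul0r ltxx /= le_eqVlt => /orP[/eqP->|m12].
    by rewrite subrr mul0r ltxx.
  have d0 : 0 < m2 - m1 by rewrite subr_gt0.
  rewrite !(pmulr_rgt0 _ d0) !(pmulr_rlt0 _ d0).
  have m1X : q * Z = 2 * m1 * X by rewrite qZ rm1.
  case: (ltgtP X 0) X0 => // sX _ /=.
    have qZ0 : q * Z < 0 by rewrite m1X pmulr_rlt0 ?mulr_gt0.
    have q1 : 0 < q by rewrite lt_neqAle q0 andbT; apply: contraTneq qZ0 => <-; rewrite mul0r ltxx.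
    by move: qZ0; rewrite pmulr_rlt0// => Z0; rewrite Z0 ltNge (ltW Z0).
  have qZ0 : 0 < q * Z by rewrite m1X !mulr_gt0.
  have q1 : 0 < q by rewrite lt_neqAle q0 andbT; apply: contraTneq qZ0 => <-; rewrite mul0r ltxx.
  by move: qZ0; rewrite pmulr_rgt0// => ->.
Qed.
End Order.

(** * The value of a greedy point, read off the sorted list of items *)

Section CriticalFraction.
Variable R : realType.

(** The smaller root t of q^2 (S + s t) = (B - a t)^2. *)
Definition lower_root (q a s B S : R) : R :=
  let P := 2 * B * a + q ^+ 2 * s in
  (P - Num.sqrt (P ^+ 2 - 4 * a ^+ 2 * (B ^+ 2 - q ^+ 2 * S))) / (2 * a ^+ 2).

(** The discriminant D is a sum of nonnegative terms as soon as the capacity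
left by the items already packed is nonnegative, so both roots are real. *)
Lemma crit_fractionE n (I : knapsack R n) (s : seq 'I_n) (k : 'I_n) :
  0 < weight I k -> 0 <= capacity I - \sum_(j <- s) weight I j ->
  crit_fraction I s k = lower_root (safety I) (weight I k) (stdev I k ^+ 2)
    (capacity I - \sum_(j <- s) weight I j) (\sum_(j <- s) stdev I j ^+ 2).
Proof.
rewrite /crit_fraction /crit_eq.
set q := safety I; set a := weight I k; set v := stdev I k ^+ 2.
set B := capacity I - _; set S := \sum_(j <- s) stdev I j ^+ 2 => a0 B0.
have S0 : 0 <= S by apply: sumr_ge0 => j _; exact: sqr_ge0.
have v0 : 0 <= v by exact: sqr_ge0.
pose P := 2 * B * a + q ^+ 2 * v.
pose D := P ^+ 2 - 4 * a ^+ 2 * (B ^+ 2 - q ^+ 2 * S).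
have D0 : 0 <= D.
  have -> : D = q ^+ 2 * (v * (4 * a * B + q ^+ 2 * v) + 4 * a ^+ 2 * S).
    by rewrite /D /P; ring.
  have aB : 0 <= 4 * a * B by rewrite !mulr_ge0// ltW.
  have qv : 0 <= q ^+ 2 * v by apply: mulr_ge0 => //; exact: sqr_ge0.
  apply: mulr_ge0; first exact: sqr_ge0.
  apply: addr_ge0; first by apply: mulr_ge0 => //; exact: addr_ge0.
  by apply: mulr_ge0 => //; rewrite mulr_ge0// sqr_ge0.
pose r := lower_root q a v B S; pose r' := (P + Num.sqrt D) / (2 * a ^+ 2).
have an0 : a != 0 by rewrite gt_eqF.
have factor t : (B - a * t) ^+ 2 - q ^+ 2 * (S + v * t) = a ^+ 2 * ((t - r) * (t - r')).
  have rr : (t - r) * (t - r') =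
      t ^+ 2 - t * (P / a ^+ 2) + (P ^+ 2 - Num.sqrt D ^+ 2) / (4 * a ^+ 4).
    by rewrite /r /r' /lower_root -/P -/D; field.
  by rewrite rr sqr_sqrtr// /D /P; field.
have rootE t : (q ^+ 2 * (S + v * t) = (B - a * t) ^+ 2) <-> (t = r \/ t = r').
  split=> [e|e].
    have : a ^+ 2 * ((t - r) * (t - r')) = 0 by rewrite -factor e subrr.
    move=> /eqP; rewrite mulf_eq0 expf_eq0 (negbTE an0) andbF /= mulf_eq0 !subr_eq0.
    by case/orP => /eqP; [left|right].
  apply/esym/eqP; rewrite -subr_eq0 factor.
  by case: e => ->; rewrite subrr ?mul0r ?mulr0.
have rr' : r <= r'.
  rewrite /r /r' /lower_root -/P -/D ler_pM2r ?invr_gt0 ?mulr_gt0 ?exprn_gt0//.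
  by rewrite lerD2l (@le_trans _ _ 0)// ?oppr_le0 sqrtr_ge0.
rewrite -/r.
have r_min : [set t | q ^+ 2 * (S + v * t) = (B - a * t) ^+ 2 /\
    forall t', q ^+ 2 * (S + v * t') = (B - a * t') ^+ 2 -> t <= t'] r.
  by split; [apply/rootE; left|move=> t /rootE[->|->]].
case: (xgetP 0 _) => [t _ [tr tmin]|/(_ r)//].
apply/eqP; rewrite eq_le tmin ?rootE; last by left.
by case: r_min => _ /(_ _ tr).
Qed.

End CriticalFraction.

Section Instance.
Variables (R : realType) (n : nat) (I : knapsack R n).
Hypothesis wp : well_posed I.

(** Items are represented by natural numbers, as in the memory of the machine,
and data indexed by items are extended by 0. *)
Definition vec (f : 'I_n -> R) (i : nat) : R := oapp f 0 (insub i).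

Lemma vecE f (i : 'I_n) : vec f i = f i. Proof. by rewrite /vec valK. Qed.

Let c := vec (profit I).
Let a := vec (weight I).
Let sg := vec (stdev I).
Let q := safety I.
Let b := capacity I.

Definition item_order (d : R) : rel nat := prec c a sg q d.

Lemma mod_weightE d i : 0 <= d -> mod_weight I d i = wt a sg q d i.
Proof.
move=> d0; rewrite /mod_weight /wt /a /sg !vecE.
by case: eqP => // ->; rewrite sqrtr0 mulr0 invr0 mulr0 mul0r addr0.
Qed.

Lemma precedesE d (i j : 'I_n) : 0 <= d -> precedes I d i j = item_order d i j.
Proof.
move=> d0; rewrite /precedes /item_order /prec /keylex /riskless /dens /risk_ratio.
case: wp => -[_ _ s0] _.
rewrite -!mod_weightE// /sg /c !vecE -/(density I d i) -/(density I d j).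
have le0 (x : R) : 0 <= x -> (x <= 0) = (x == 0) :> bool by move=> x0; rewrite eq_le x0 andbT.
rewrite !(le0 _ d0) !(le0 _ (s0 _)).
case: (d == 0); case: (stdev I i == 0); case: (stdev I j == 0) => //=;
  rewrite ?mulr1n ?mulr0n ?ltxx ?ltr01 ?ltr10 //=;
  case: (ltgtP (density I d i) (density I d j)) => //= _;
  by case: (ltgtP (stdev I i ^+ 2 / profit I i) (stdev I j ^+ 2 / profit I j)).
Qed.

Definition sorted_items (d : R) : seq nat := sort (item_order d) (iota 0 n).

Lemma sorted_itemsE d : 0 <= d -> sorted_items d = map val (tau I d).
Proof.
move=> d0; rewrite /sorted_items -val_enum_ord /tau sort_map.
by congr (map _ (sort _ _)); apply/funext => i; apply/funext => j; rewrite precedesE.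
Qed.

Lemma size_tau d : size (tau I d) = n. Proof. by rewrite size_sort size_enum_ord. Qed.
Lemma tau_uniq d : uniq (tau I d). Proof. by rewrite sort_uniq enum_uniq. Qed.

Definition nload (s : seq nat) : R :=
  \sum_(j <- s) a j + q * Num.sqrt (\sum_(j <- s) sg j ^+ 2).

Lemma loadE (s : seq 'I_n) : nload (map val s) = load I s.
Proof.
rewrite /nload /load !big_map; congr (_ + q * Num.sqrt _);
  by apply: eq_bigr => j _; rewrite /a /sg vecE.
Qed.

Definition greedy_value (o : seq nat) (m : nat) : R :=
  let k := nth 0%N o m in
  \sum_(j <- take m o) c j +
  c k * lower_root q (a k) (sg k ^+ 2) (b - \sum_(j <- take m o) a j)
          (\sum_(j <- take m o) sg j ^+ 2).

(** The critical position m, counted from 0, of the ordering [o]. *)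
Definition critical (o : seq nat) (m : nat) : Prop :=
  [/\ (m < n)%N, b <= nload (take m.+1 o) & forall k, (k < m)%N -> nload (take k.+1 o) < b].

Lemma nb_full_critical d : 0 <= d -> critical (sorted_items d) (nb_full I d).
Proof.
move=> d0; rewrite sorted_itemsE//; case: wp => _ [b0 _ bl _].
have n0 : (0 < n)%N.
  case: (posnP n) => // nz; exfalso; move: bl; rewrite /load.
  rewrite (_ : enum _ = [::]) ?big_nil ?sqrtr0 ?mulr0 ?addr0 ?ltNge ?(ltW b0)//.
  by apply/size0nil; rewrite size_enum_ord.
rewrite /critical /nb_full.
set p := fun k => _.
have hasp : has p (iota 0 n).
  apply/hasP; exists n.-1; first by rewrite mem_iota leq0n add0n prednK// leqnn.
  rewrite /p prednK// take_oversize ?size_tau// ltW//.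
  have pe : perm_eq (tau I d) (enum 'I_n) by rewrite perm_sort.
  by rewrite /load !(perm_big _ pe).
have mn : (find p (iota 0 n) < n)%N by move: hasp; rewrite has_find size_iota.
split=> // [|k km].
  rewrite -map_take loadE.
  by have := nth_find 0%N hasp; rewrite nth_iota// add0n.
have := before_find 0%N km; rewrite nth_iota ?(ltn_trans km)// add0n /p => /negbT.
by rewrite -ltNge -map_take loadE.
Qed.

Lemma critical_uniq o m m' : critical o m -> critical o m' -> m = m'.
Proof.
move=> [_ bm mb] [_ bm' mb'].
case: (ltngtP m m') => // [/mb'|/mb]; first by rewrite ltNge bm.
by rewrite ltNge bm'.
Qed.

Lemma critical_rest d m : 0 <= d -> critical (sorted_items d) m ->
  0 <= b - \sum_(j <- take m (sorted_items d)) a j.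
Proof.
case: wp => _ [b0 rh _ _] d0; have q0 : 0 <= q by apply: safety_ge0; case/andP: rh.
case: m => [_|m [_ _ /(_ m (ltnSn m))]]; first by rewrite take0 big_nil subr0 ltW.
rewrite subr_ge0 => lb; apply: ltW; apply: le_lt_trans lb.
by rewrite lerDl mulr_ge0 ?sqrtr_ge0.
Qed.

(** This identity shows that the value depends on d only through the ordering,
and it is what the linear scan of the program computes. *)
Lemma ncr_valueE d m : 0 <= d -> critical (sorted_items d) m ->
  ncr_value I d = greedy_value (sorted_items d) m.
Proof.
move=> d0 cm; have mE := critical_uniq cm (nb_full_critical d0).
have := critical_rest d0 cm; case: cm => mn _ _.
case: wp => -[_ a0 _] _.
rewrite /greedy_value sorted_itemsE// => rest.
have k0 : 'I_n by exact: Ordinal mn.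
set k := nth k0 (tau I d) m.
have -> : nth 0%N (map val (tau I d)) m = k by rewrite (nth_map k0) ?size_tau.
have sumE (f : 'I_n -> R) : \sum_(j <- take m (map val (tau I d))) vec f j =
    \sum_(j <- take m (tau I d)) f j.
  by rewrite -map_take big_map; apply: eq_bigr => j _; rewrite vecE.
have sumE2 : \sum_(j <- take m (map val (tau I d))) sg j ^+ 2 =
    \sum_(j <- take m (tau I d)) stdev I j ^+ 2.
  by rewrite -map_take big_map; apply: eq_bigr => j _; rewrite /sg vecE.
move: rest; rewrite /a /c !sumE sumE2 /sg !vecE => rest.
rewrite -crit_fractionE//.
rewrite /ncr_value.
have pe : perm_eq (index_enum 'I_n) (tau I d) by rewrite perm_sym /tau perm_sort enumT.
rewrite (perm_big _ pe) /= (big_nth k0) size_tau.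
rewrite (@big_cat_nat _ _ _ m) ?(ltnW mn)//= (@big_ltn _ _ _ m)//.
have gp i : (i < n)%N -> greedy_point I d (nth k0 (tau I d) i) =
    if (i < m)%N then 1 else if i == m then crit_fraction I (take m (tau I d)) k else 0.
  move=> lin; rewrite /greedy_point -mE index_uniq ?size_tau ?tau_uniq//.
  by case: ltngtP => // ->.
congr (_ + _).
  rewrite [RHS](big_nth k0) size_takel ?size_tau ?(ltnW mn)//.
  apply: eq_big_nat => i /andP[_ im].
  by rewrite gp; [rewrite im nth_take// mulr1|exact: ltn_trans mn].
rewrite gp// ltnn eqxx -/k big_nat big1 ?addr0// => i /andP[mi lin].
by rewrite gp// ltnNge (ltnW mi) /= gtn_eqF// mulr0.
Qed.

End Instance.

(** * Finitely many candidates suffice *)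

Lemma seq_has_max (R : realType) (s : seq R) : s <> [::] ->
  exists2 x, x \in s & forall y, y \in s -> y <= x.
Proof.
elim: s => // x [|y s] IH _.
  by exists x; rewrite ?mem_head// => y; rewrite inE => /eqP->.
have [//|z zs zmax] := IH.
case: (leP z x) => [zx|/ltW xz].
  exists x; rewrite ?mem_head// => t; rewrite inE => /orP[/eqP->//|/zmax tz].
  exact: le_trans zx.
exists z; first by rewrite inE zs orbT.
by move=> t; rewrite inE => /orP[/eqP->//|/zmax].
Qed.

Section Candidates.
Variables (R : realType) (n : nat) (I : knapsack R n).
Hypothesis wp : well_posed I.

Definition candidate (i j : nat) : R :=
  swap_point (vec (profit I)) (vec (weight I)) (vec (stdev I)) (safety I) i j.

Lemma candidate_ge0 i j : 0 <= candidate i j. Proof. exact: sqr_ge0. Qed.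

Lemma sorted_items_const d1 d2 : 0 < d1 <= d2 ->
  (forall i j : nat, (i < n)%N -> (j < n)%N -> ~~ (d1 < candidate i j <= d2)) ->
  sorted_items I d1 = sorted_items I d2.
Proof.
move=> d12 noswap; rewrite /sorted_items -val_enum_ord.
have sm e : sort e (map val (enum 'I_n)) = map val (sort (relpre val e) (enum 'I_n)).
  by rewrite sort_map.
rewrite !sm.
suff -> : relpre val (item_order I d1) = relpre val (item_order I d2) :> rel 'I_n by reflexivity.
apply/funext => i; apply/funext => j.
case: wp => -[c0 a0 _] [_ /andP[rh _] _ _].
apply: prec_const; rewrite ?vecE//; first exact: safety_ge0.
exact: (noswap _ _ (ltn_ord i) (ltn_ord j)).
Qed.

Lemma ncr_value_sorted_items d1 d2 : 0 <= d1 -> 0 <= d2 ->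
  sorted_items I d1 = sorted_items I d2 -> ncr_value I d1 = ncr_value I d2.
Proof.
move=> d10 d20 eqo; have cm := nb_full_critical wp d10.
by rewrite (ncr_valueE wp d10 cm) eqo -ncr_valueE// -eqo.
Qed.

(** A point d > 0 has the ordering of the largest swap point that is at most d;
if there is none, d lies in the leftmost interval, which also contains m / 2. *)
Lemma candidates_optimal (p m : R) : 0 <= p -> 0 < m ->
  (forall i j : nat, (i < n)%N -> (j < n)%N ->
     ncr_value I (candidate i j) <= ncr_value I p /\
     (0 < candidate i j -> m <= candidate i j)) ->
  ncr_value I 0 <= ncr_value I p -> ncr_value I (m / 2) <= ncr_value I p ->
  ncr_optimal I p.
Proof.
move=> p0 m0; rewrite /ncr_optimal; move: (ncr_value I) ncr_value_sorted_items => v same_v.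
move=> cand v0 vm; split=> // d; rewrite le_eqVlt => /orP[/eqP<-//|d0].
pose L := [seq candidate i j | i <- iota 0 n, j <- iota 0 n].
have inL i j : (i < n)%N -> (j < n)%N -> candidate i j \in L.
  by move=> lin ljn; apply: allpairs_f; rewrite mem_iota.
pose L' := [seq x <- L | 0 < x <= d].
have [L'0|L'n0] := eqVneq L' [::].
  have noc i j : (i < n)%N -> (j < n)%N -> ~~ (0 < candidate i j <= d).
    move=> lin ljn; apply/negP => cij.
    have : candidate i j \in L' by rewrite mem_filter cij inL.
    by rewrite L'0.
  have m20 : 0 < m / 2 by rewrite divr_gt0.
  suff same : sorted_items I d = sorted_items I (m / 2).
    by rewrite (same_v _ _ (ltW d0) (ltW m20) same).
  case: (leP d (m / 2)) => dm; [|apply/esym]; apply: sorted_items_const;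
    rewrite ?d0 ?m20 ?dm ?(ltW dm)// => i j lin ljn; apply/negP => /andP[c1 c2].
    have cm : m <= candidate i j by apply: (cand _ _ lin ljn).2; exact: lt_trans c1.
    by lra.
  by have := noc _ _ lin ljn; rewrite c2 (lt_trans m20 c1).
have [x xL' xmax] := seq_has_max (elimN eqP L'n0).
move: xL'; rewrite mem_filter => /andP[/andP[x0 xd]] /allpairsP[[i j] /= []].
rewrite !mem_iota !add0n => /andP[_ lin] /andP[_ ljn] xE.
rewrite -(_ : v x = v d); first by rewrite xE; exact: (proj1 (cand _ _ lin ljn)).
apply: same_v; [exact: ltW|exact: ltW|].
apply: sorted_items_const => [|k l lkn lln]; first by rewrite x0.
apply/negP => /andP[c1 c2].
have : candidate k l <= x by apply: xmax; rewrite mem_filter c2 (lt_trans x0 c1) inL.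
by rewrite leNgt c1.
Qed.

End Candidates.

(** * A program logic with running times *)

Section Logic.
Variable R : realType.
Implicit Types (st : state R) (p : cmd).

(** Total correctness with an upper bound on the time: the form in which the
costs of sub-programs add up. *)
Definition runs p st (T : nat) (Q : state R -> Prop) : Prop :=
  exists st' t, [/\ exec p st st' t, (t <= T)%N & Q st'].

Lemma runs_weaken p st T T' (Q Q' : state R -> Prop) :
  runs p st T Q -> (T <= T')%N -> (forall st', Q st' -> Q' st') -> runs p st T' Q'.
Proof.
move=> [st' [t [e tT q]]] TT' QQ'; exists st', t; split=> //; last exact: QQ'.
exact: leq_trans TT'.
Qed.

Lemma runs_seq p1 p2 st T1 T2 (Q Q' : state R -> Prop) :
  runs p1 st T1 Q -> (forall st', Q st' -> runs p2 st' T2 Q') ->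
  runs (Seq p1 p2) st (T1 + T2) Q'.
Proof.
move=> [st1 [t1 [e1 tT1 q1]]] /(_ _ q1)[st2 [t2 [e2 tT2 q2]]].
by exists st2, (t1 + t2)%N; split; [exact: ExecSeq e1 e2|exact: leq_add|].
Qed.

(** The number N of iterations is known in advance, which gives termination and
the time bound at once. *)
Lemma runs_while e p T N (Inv : nat -> state R -> Prop) :
  (forall k st, (k < N)%N -> Inv k st -> beval st e /\ runs p st T (Inv k.+1)) ->
  (forall st, Inv N st -> ~~ beval st e) ->
  forall st, Inv 0%N st ->
    runs (While e p) st (N * (bcost e + T).+1 + (bcost e).+1) (Inv N).
Proof.
move=> step stop st.
have loop d : (d <= N)%N -> forall st1, Inv (N - d)%N st1 ->
    runs (While e p) st1 (d * (bcost e + T).+1 + (bcost e).+1) (Inv N).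
  elim: d => [_|d IH dN] st1 inv1.
    rewrite subn0 in inv1; exists st1, (bcost e).+1; split=> //.
    exact/ExecWhileEnd/stop.
  have [be [st2 [t2 [e2 tT2 inv2]]]] := step (N - d.+1)%N st1 ltac:(lia) inv1.
  have [|st3 [t3 [e3 tT3 inv3]]] := IH (ltnW dN) st2.
    by rewrite (_ : N - d = (N - d.+1).+1)%N//; lia.
  exists st3, (bcost e + t2 + t3).+1; split=> //; first exact: ExecWhileLoop e3.
  by rewrite mulSn; lia.
by move=> inv0; apply: (loop N) => //; rewrite subnn.
Qed.

Fixpoint iwrites p : seq nat :=
  match p with
  | Skip | RStore _ _ _ => [::]
  | IStore k _ _ => [:: k]
  | Seq p1 p2 | If _ p1 p2 => iwrites p1 ++ iwrites p2
  | While _ p1 => iwrites p1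
  end.

Fixpoint rwrites p : seq nat :=
  match p with
  | Skip | IStore _ _ _ => [::]
  | RStore k _ _ => [:: k]
  | Seq p1 p2 | If _ p1 p2 => rwrites p1 ++ rwrites p2
  | While _ p1 => rwrites p1
  end.

(** A program leaves unchanged every array that it nowhere stores to; since
distinct variables live in distinct arrays, invariants need only mention what
a loop modifies. *)
Definition framed p st st' : Prop :=
  (forall k, k \notin iwrites p -> imem st' k = imem st k) /\
  (forall k, k \notin rwrites p -> rmem st' k = rmem st k).

Lemma upd_other T (m : nat -> nat -> T) k i v k' : k' != k -> upd m k i v k' = m k'.
Proof. by move=> /negbTE kk'; apply/funext => i'; rewrite /upd kk'. Qed.

Lemma exec_framed p st st' t : exec p st st' t -> framed p st st'.
Proof.
elim=> {p st st' t} [st|st k e v|st k e v|s1 s2 s3 p1 p2 t1 t2 _ [i1 r1] _ [i2 r2]|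
   st st' e p1 p2 t _ [i1 r1]|st e p _|s1 s2 s3 e p t1 t2 _ _ [i1 r1] _ [i2 r2]]; split=> //= k';
  rewrite ?inE ?mem_cat ?negb_or.
- by move=> kk'; rewrite upd_other.
- by move=> kk'; rewrite upd_other.
- by move=> /andP[k1 k2]; rewrite i2// i1.
- by move=> /andP[k1 k2]; rewrite r2// r1.
- by move=> /andP[k1 k2]; apply: i1; case: ifP.
- by move=> /andP[k1 k2]; apply: r1; case: ifP.
- by move=> k1; rewrite i2// i1.
- by move=> k1; rewrite r2// r1.
Qed.

Lemma runs_framed p st T Q :
  runs p st T Q -> runs p st T (fun st' => Q st' /\ framed p st st').
Proof.
move=> [st' [t [e tT q]]]; exists st', t; split=> //; split=> //.
exact: exec_framed e.
Qed.

Fixpoint loopfree p : bool :=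
  match p with
  | Skip | IStore _ _ _ | RStore _ _ _ => true
  | Seq p1 p2 | If _ p1 p2 => loopfree p1 && loopfree p2
  | While _ _ => false
  end.

Fixpoint denote p st : state R :=
  match p with
  | Skip | While _ _ => st
  | IStore k e v => State (upd (imem st) k (ieval st e) (ieval st v)) (rmem st)
  | RStore k e v => State (imem st) (upd (rmem st) k (ieval st e) (reval st v))
  | Seq p1 p2 => denote p2 (denote p1 st)
  | If e p1 p2 => if beval st e then denote p1 st else denote p2 st
  end.

(** For a conditional, the costs of both branches are added: cruder than their
maximum, but a bound all the same. *)
Fixpoint scost p : nat :=
  match p with
  | Skip | While _ _ => 0
  | IStore _ e v => (icost e + icost v).+1
  | RStore _ e v => (icost e + rcost v).+1
  | Seq p1 p2 => scost p1 + scost p2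
  | If e p1 p2 => (bcost e + (scost p1 + scost p2)).+1
  end.

Lemma runs_straight p st (Q : state R -> Prop) :
  loopfree p -> Q (denote p st) -> runs p st (scost p) Q.
Proof.
move=> lf q; suff [t e tT] : exists2 t, exec p st (denote p st) t & (t <= scost p)%N.
  by exists (denote p st), t.
elim: p st lf {q} => //= [|k e v|k e v|p1 IH1 p2 IH2|e p1 IH1 p2 IH2] st.
- by exists 0%N => //; constructor.
- by move=> _; exists (icost e + icost v).+1 => //; constructor.
- by move=> _; exists (icost e + rcost v).+1 => //; constructor.
- move=> /andP[l1 l2].
  have [t1 e1 tT1] := IH1 st l1; have [t2 e2 tT2] := IH2 (denote p1 st) l2.
  by exists (t1 + t2)%N; [exact: ExecSeq e1 e2|exact: leq_add].
- move=> /andP[l1 l2]; case be: (beval st e).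
    have [t1 e1 tT1] := IH1 st l1; exists (bcost e + t1).+1; last by lia.
    by apply: ExecIf; rewrite be.
  have [t1 e1 tT1] := IH2 st l2; exists (bcost e + t1).+1; last by lia.
  by apply: ExecIf; rewrite be.
Qed.

Definition ivar k := ILoad k (IConst 0).
Definition rvar k := RLoad k (IConst 0).
Definition iset k e := IStore k (IConst 0) e.
Definition rset k e := RStore k (IConst 0) e.
Definition ilt e1 e2 := BNot (BLei e2 e1).
Definition rlt e1 e2 := BNot (BLer e2 e1).
Definition bor e1 e2 := BNot (BAnd (BNot e1) (BNot e2)).

(** The bound n is read from cell 0 of index array 0, where the input has it. *)
Definition for_items k p :=
  Seq (iset k (IConst 0))
      (While (ilt (ivar k) (ivar 0)) (Seq p (iset k (IAdd (ivar k) (IConst 1))))).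

Definition with_counter k v st := State (upd (imem st) k 0%N v) (rmem st).

(** The constants: 13 pays for testing the bound and stepping the counter, 10 for
setting the counter and for the last test. *)
Lemma runs_for_items k p st n T (Inv : nat -> state R -> Prop) :
  k != 0%N -> k \notin iwrites p -> 0%N \notin iwrites p -> imem st 0 0 = n ->
  Inv 0%N (with_counter k 0 st) ->
  (forall m st', (m < n)%N -> imem st' k 0 = m -> imem st' 0 0 = n -> Inv m st' ->
     runs p st' T (fun st'' => Inv m.+1 (with_counter k m.+1 st''))) ->
  runs (for_items k p) st (n * (T + 13) + 10) (Inv n).
Proof.
move=> k0 kp p0 stn inv0 step.
pose J m st' := [/\ imem st' k 0 = m, imem st' 0 0 = n & Inv m st'].
have loop := @runs_while (ilt (ivar k) (ivar 0))
  (Seq p (iset k (IAdd (ivar k) (IConst 1)))) (T + 6) n J.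
rewrite (_ : n * (T + 13) + 10 = 3 + (n * (6 + (T + 6)).+1 + 7))%N; last by lia.
apply: runs_seq; first by apply: (@runs_straight _ _ (J 0%N)) => //=; split;
  rewrite /= ?/upd ?eqxx// eq_sym (negbTE k0).
move=> st' J0; apply: runs_weaken; first apply: loop J0.
- move=> m st1 mn [st1k st1n inv]; split; first by rewrite /= st1k st1n -ltnNge.
  apply: runs_seq; first exact: runs_framed (step m st1 mn st1k st1n inv).
  move=> st2 [inv2 [fi _]]; apply: runs_straight => //=.
  rewrite (fi _ kp) st1k addn1; split=> //=; first by rewrite /upd !eqxx.
  by rewrite /upd eq_sym (negbTE k0) /= fi.
- by move=> st1 [st1k st1n _]; rewrite /= st1k st1n leqnn.
- by [].
- by move=> st1 [].
Qed.

End Logic.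

(** * Merge sort on lists, and array segments as lists *)

Section MergePass.
Variables (T : Type) (le : rel T).
Implicit Types (s : seq T) (w : nat).
Local Open Scope nat_scope.

(** One round of bottom-up merge sort: neighbouring blocks of width w are merged
pairwise.  The fuel f only has to reach the length of the list. *)
Fixpoint merge_pass_rec (f w : nat) (s : seq T) : seq T :=
  if f is f'.+1 then
    merge le (take w s) (take w (drop w s)) ++ merge_pass_rec f' w (drop (w + w) s)
  else s.

Definition merge_pass w s := merge_pass_rec (size s) w s.

Lemma merge_pass_rec_nil f w : merge_pass_rec f w [::] = [::].
Proof. by elim: f. Qed.

Lemma merge_pass_recE f w s : 0 < w -> size s <= f ->
  merge_pass_rec f w s = merge_pass w s.
Proof.
move=> w0; rewrite /merge_pass; move sz: (size s) => m.
elim/ltn_ind: m => m IH in f s sz *.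
case: m => [|m] in sz IH *; first by rewrite (size0nil sz) merge_pass_rec_nil.
case: f => // f mf /=; congr (_ ++ _).
have szd : size (drop (w + w) s) <= m by rewrite size_drop sz; lia.
by rewrite (IH _ _ f _ erefl) ?(IH _ _ m _ erefl)//; lia.
Qed.

Lemma merge_passE w s : 0 < w -> 0 < size s ->
  merge_pass w s =
    merge le (take w s) (take w (drop w s)) ++ merge_pass w (drop (w + w) s).
Proof.
move=> w0; rewrite {1}/merge_pass; case sz: (size s) => [//|m] _ /=.
by rewrite merge_pass_recE// size_drop sz; lia.
Qed.

Definition blocks_sorted w s := forall k, sorted le (take w (drop (k * w) s)).

(** The block number k of the result comes from the blocks 2k and 2k + 1 of [s];
the first merged block has length w + w unless the list ends before that. *)
Lemma merge_pass_sorted w s : 0 < w -> total le ->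
  blocks_sorted w s -> blocks_sorted (w + w) (merge_pass w s).
Proof.
move=> w0 le_total; move sz: (size s) => m.
elim/ltn_ind: m => m IH in s sz * => rs k.
case: m => [|m] in sz IH; first by rewrite (size0nil sz).
rewrite merge_passE ?sz//; set M := merge _ _ _.
have szM : size M = minn (w + w) (size s).
  by rewrite /M size_merge size_cat !size_take size_drop; case: ifP; case: ifP; lia.
have rest : size s <= w + w -> drop (w + w) s = [::] by exact: drop_oversize.
case: k => [|k].
  rewrite mul0n drop0.
  have -> : take (w + w) (M ++ merge_pass w (drop (w + w) s)) = M.
    case: (leqP (size s) (w + w)) => ws.
      by rewrite rest// cats0 take_oversize// szM geq_minl.
    by rewrite take_size_cat// szM; lia.
  rewrite merge_sorted//; first by have := rs 0; rewrite mul0n drop0.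
  by have := rs 1; rewrite mul1n.
case: (leqP (size s) (w + w)) => ws.
  rewrite rest// cats0 drop_oversize// szM (leq_trans (geq_minl _ _))//.
  by rewrite mulSn leq_addr.
have -> : drop (k.+1 * (w + w)) (M ++ merge_pass w (drop (w + w) s)) =
    drop (k * (w + w)) (merge_pass w (drop (w + w) s)).
  rewrite drop_cat szM (minn_idPl (ltnW ws)) ifF; first by rewrite mulSn addKn.
  by rewrite mulSn ltnNge leq_addr.
apply: (IH (size (drop (w + w) s))) => //; first by rewrite size_drop; lia.
move=> l; rewrite drop_drop (_ : l * w + (w + w) = l.+2 * w); last by lia.
exact: rs.
Qed.

End MergePass.

Lemma merge_pass_perm (T : eqType) (le : rel T) w s : (0 < w)%N ->
  perm_eq (merge_pass le w s) s.
Proof.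
move=> w0; move sz: (size s) => m.
elim/ltn_ind: m => m IH in s sz *.
case: m => [|m] in sz IH *; first by rewrite (size0nil sz).
rewrite merge_passE ?sz//.
rewrite -[X in perm_eq _ X](cat_take_drop (w + w) s) perm_cat//; last first.
  by apply: (IH (size (drop (w + w) s))) => //; rewrite size_drop sz; lia.
by rewrite perm_merge takeD.
Qed.

(** Loop invariants speak of arrays through such lists.  Locked, so that
simplifying a concatenation does not expand it. *)
HB.lock Definition slice (T : Type) (A : nat -> T) (i e : nat) : seq T :=
  [seq A x | x <- iota i (e - i)%N].

Section Slice.
Local Open Scope nat_scope.
Variable T : Type.
Implicit Types A B : nat -> T.

Lemma sliceE A i e : slice A i e = [seq A x | x <- iota i (e - i)].
Proof. by rewrite unlock. Qed.

Lemma slice_nil A i e : e <= i -> slice A i e = [::].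
Proof. by rewrite !sliceE -subn_eq0 => /eqP->. Qed.

Lemma slice_cons A i e : i < e -> slice A i e = A i :: slice A i.+1 e.
Proof. by move=> ie; rewrite !sliceE (_ : e - i = (e - i.+1).+1)//; lia. Qed.

Lemma slice_rcons A i e : i <= e -> slice A i e.+1 = rcons (slice A i e) (A e).
Proof.
by move=> ie; rewrite !sliceE subSn// -addn1 iotaD map_cat subnKC// cats1.
Qed.

Lemma size_slice A i e : size (slice A i e) = e - i.
Proof. by rewrite sliceE size_map size_iota. Qed.

Lemma eq_slice A B i e : (forall k, i <= k < e -> A k = B k) -> slice A i e = slice B i e.
Proof.
move=> AB; rewrite !sliceE; apply/eq_in_map => k; rewrite mem_iota => /andP[ik kd].
by apply: AB; lia.
Qed.

Lemma take_slice A i e k : take k (slice A i e) = slice A i (minn (i + k) e).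
Proof. by rewrite !sliceE -map_take take_iota; congr (map _ (iota _ _)); lia. Qed.

Lemma drop_slice A i e k : drop k (slice A i e) = slice A (minn (i + k) e) e.
Proof.
rewrite !sliceE -map_drop drop_iota.
case: (leqP (i + k) e) => ie; first by congr (map _ (iota _ _)); lia.
by rewrite (_ : e - i - k = 0)%N ?subnn//; lia.
Qed.

Lemma slice_upd A i e x : i <= e ->
  slice (fun k => if k == e then x else A k) i e.+1 = rcons (slice A i e) x.
Proof.
move=> ie; rewrite slice_rcons// eqxx; congr rcons; apply: eq_slice => k /andP[_ ke].
by rewrite ltn_eqF.
Qed.

End Slice.

(** Allotment of the arrays.  Index arrays: 0 the number n of items; 1 the items
in their current order; 2 the output of a merge pass; 3 and 4 the pair of items
whose swap point is tried; 5 the block width; 6 the running position; 7 and 8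
the next cell of the left and of the right block; 9 and 10 the ends of these
blocks.  Real arrays: 0 to 3 the input; 4 the best point and its value; 5 the
point d under evaluation; 6 the minimum of 1 and the
positive candidates met so far; 7, 8 and 9
the weight, variance and profit of the packed items; 10 the value at d. *)

Definition rdens e : rexp :=
  RDiv (RLoad 0 e) (RAdd (RLoad 1 e)
    (RMul (RDiv (RLoad 3 (IConst 1)) (RMul (RConst 2) (RSqrt (rvar 5))))
       (RMul (RLoad 2 e) (RLoad 2 e)))).
Definition rrisk e : rexp := RDiv (RMul (RLoad 2 e) (RLoad 2 e)) (RLoad 0 e).
Definition briskless e1 e2 : bexp :=
  BAnd (BLer (rvar 5) (RConst 0))
    (BAnd (BLer (RLoad 2 e1) (RConst 0)) (BNot (BLer (RLoad 2 e2) (RConst 0)))).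
Definition blex (b1 b2 k : bexp) : bexp := bor b1 (BAnd (BNot b2) k).
Definition bprec e1 e2 : bexp :=
  blex (briskless e1 e2) (briskless e2 e1)
    (blex (rlt (rdens e2) (rdens e1)) (rlt (rdens e1) (rdens e2))
       (blex (rlt (rrisk e2) (rrisk e1)) (rlt (rrisk e1) (rrisk e2)) (BLei e1 e2))).

Section Bprec.
Variable R : realType.
Implicit Types st : state R.

Definition st_prec st : rel nat :=
  prec (rmem st 0) (rmem st 1) (rmem st 2) (rmem st 3 1) (rmem st 5 0).

Lemma beval_bor st e1 e2 : beval st (bor e1 e2) = beval st e1 || beval st e2.
Proof. by rewrite /= negb_and !negbK. Qed.

Lemma beval_blex st e1 e2 k :
  beval st (blex e1 e2 k) = beval st e1 || ~~ beval st e2 && beval st k.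
Proof. by rewrite /blex beval_bor. Qed.

Lemma beval_briskless st e1 e2 :
  beval st (briskless e1 e2) =
    (riskless (rmem st 2) (rmem st 5 0) (ieval st e2) <
     riskless (rmem st 2) (rmem st 5 0) (ieval st e1)).
Proof.
rewrite /riskless /= ltr_nat.
by case: (rmem st 5 0 <= 0); case: (rmem st 2 _ <= 0); case: (rmem st 2 _ <= 0).
Qed.

Lemma beval_bprec st e1 e2 :
  beval st (bprec e1 e2) = st_prec st (ieval st e1) (ieval st e2).
Proof.
rewrite /bprec 3!beval_blex !beval_briskless /st_prec /prec /keylex.
by rewrite /rlt /= -!ltNge.
Qed.

End Bprec.

(** * The merge pass as a program *)

Definition imin e1 e2 := ISub e1 (ISub e1 e2).

(** Once the output reaches the end of the current pair of blocks, the next pair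
is opened.  The two minima, computed with truncated subtraction, cut the last
blocks off at n. *)
Definition merge_setup : cmd :=
  If (BLei (ivar 10) (ivar 6))
    (Seq (iset 7 (ivar 6))
    (Seq (iset 9 (imin (IAdd (ivar 6) (ivar 5)) (ivar 0)))
    (Seq (iset 8 (ivar 9))
         (iset 10 (imin (IAdd (ivar 6) (IAdd (ivar 5) (ivar 5))) (ivar 0))))))
    Skip.

Definition take_next k : cmd :=
  Seq (IStore 2 (ivar 6) (ILoad 1 (ivar k))) (iset k (IAdd (ivar k) (IConst 1))).

Definition merge_move : cmd :=
  If (BAnd (ilt (ivar 7) (ivar 9))
           (bor (BLei (ivar 10) (ivar 8)) (bprec (ILoad 1 (ivar 7)) (ILoad 1 (ivar 8)))))
     (take_next 7) (take_next 8).

Definition merge_init : cmd :=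
  Seq (iset 7 (IConst 0)) (Seq (iset 8 (IConst 0)) (Seq (iset 9 (IConst 0)) (iset 10 (IConst 0)))).

Definition merge_copy : cmd := IStore 1 (ivar 6) (ILoad 2 (ivar 6)).

Definition merge_pass_prog : cmd :=
  Seq merge_init (Seq (for_items 6 (Seq merge_setup merge_move)) (for_items 6 merge_copy)).

Section MergePassProg.
Variable R : realType.
Implicit Types st : state R.
Variables (w n : nat) (A : nat -> nat) (rm : nat -> nat -> R).
Hypothesis w0 : (0 < w)%N.

Let le := st_prec (State (fun _ _ => 0%N) rm).

(** The state when m cells of the output are filled.  The result of the whole
pass splits into the part written so far, the merge of what is left of the two
open blocks, and the pass over the blocks not yet opened; [merging_count] says
that the merge of the open blocks will fill the output exactly up to their end. *)
Record merging (m : nat) st : Prop := Merging {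
  merging_w : imem st 5 0 = w;
  merging_A : imem st 1 = A;
  merging_rm : rmem st = rm;
  merging_count : (m + (imem st 9 0 - imem st 7 0) + (imem st 10 0 - imem st 8 0) = imem st 10 0)%N;
  merging_end : (imem st 10 0 <= n)%N;
  merging_out : slice (imem st 2) 0 m ++
    merge le (slice A (imem st 7 0) (imem st 9 0)) (slice A (imem st 8 0) (imem st 10 0)) ++
    merge_pass le w (slice A (imem st 10 0) n) = merge_pass le w (slice A 0 n) }.

Lemma merge_setup_spec m st : (m < n)%N -> imem st 6 0 = m -> imem st 0 0 = n ->
  merging m st ->
  runs merge_setup st (scost merge_setup)
    (fun st' => merging m st' /\ (m < imem st' 10 0)%N).
Proof.
move=> mn stm stn [stw stA strm cnt en out]; apply: runs_straight => //.
rewrite /= stm; case: ifPn => [jm|]; last by rewrite -ltnNge => mlt; split.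
have cnt' : imem st 10 0 = m by lia.
rewrite /upd /= !stm !stw !stn -!minnE; split; last by rewrite leq_min; lia.
split=> //=; [lia|exact: geq_minr|].
move: out; rewrite cnt' (slice_nil _ (_ : imem st 9 0 <= imem st 7 0)%N); last by lia.
rewrite (slice_nil _ (_ : m <= imem st 8 0)%N) /=; last by lia.
move=> <-; congr (_ ++ _); rewrite [RHS]merge_passE ?size_slice ?subn_gt0//.
rewrite !drop_slice !take_slice.
by rewrite (_ : minn (minn (m + w) n + w) n = minn (m + (w + w)) n)%N//; lia.
Qed.

Lemma merge_move_spec m st : (m < n)%N -> imem st 6 0 = m -> (m < imem st 10 0)%N ->
  merging m st ->
  runs merge_move st (scost merge_move) (fun st' => merging m.+1 (with_counter 6 m.+1 st')).
Proof.
move=> mn stm mj [stw stA strm cnt en out]; apply: runs_straight => //.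
have stle x y : st_prec st x y = le x y by rewrite /le /st_prec strm.
have movei : (imem st 7 0 < imem st 9 0)%N ->
    (imem st 10 0 <= imem st 8 0)%N || le (A (imem st 7 0)) (A (imem st 8 0)) ->
    merging m.+1 (with_counter 6 m.+1 (denote (take_next 7) st)).
  move=> i_lt pick; rewrite /with_counter /= stm; split=> //=; rewrite /upd /= ?addn1; [lia|].
  rewrite stA slice_upd// cat_rcons.
  move: out; rewrite (slice_cons _ i_lt) => <-; congr (_ ++ _).
  case: (leqP (imem st 10 0) (imem st 8 0)) pick => [jn _|j_lt /= lij].
    by rewrite (slice_nil _ jn) /= ; case: (slice A _ _).
  by rewrite (slice_cons _ j_lt) /= lij.
have movej : (imem st 8 0 < imem st 10 0)%N ->
    ~~ ((imem st 7 0 < imem st 9 0)%N && le (A (imem st 7 0)) (A (imem st 8 0))) ->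
    merging m.+1 (with_counter 6 m.+1 (denote (take_next 8) st)).
  move=> j_lt pick; rewrite /with_counter /= stm; split=> //=; rewrite /upd /= ?addn1; [lia|].
  rewrite stA slice_upd// cat_rcons.
  move: out; rewrite (slice_cons _ j_lt) => <-; congr (_ ++ _).
  case: (ltnP (imem st 7 0) (imem st 9 0)) pick => [i_lt /= /negbTE lij|i_ge _].
    by rewrite (slice_cons _ i_lt) /= lij.
  by rewrite (slice_nil _ i_ge).
rewrite /merge_move [denote _ _]/= -/(denote (take_next 7) st) -/(denote (take_next 8) st).
have -> : (beval st (ilt (ivar 7) (ivar 9)) &&
    beval st (bor (BLei (ivar 10) (ivar 8)) (bprec (ILoad 1 (ivar 7)) (ILoad 1 (ivar 8))))) =
    (imem st 7 0 < imem st 9 0)%N && ((imem st 10 0 <= imem st 8 0)%N ||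
      le (A (imem st 7 0)) (A (imem st 8 0))).
  by rewrite beval_bor beval_bprec stle /= stA -ltnNge.
case: (ltnP (imem st 7 0) (imem st 9 0)) => [i_lt|i_ge] /=; last first.
  by apply: movej; [lia|rewrite ltnNge i_ge].
case: ifP => [pick|/negbT]; first exact: movei.
by rewrite negb_or -ltnNge => /andP[j_lt nle]; apply: movej => //; rewrite i_lt.
Qed.

End MergePassProg.

Section MergeSortProg.
Variable R : realType.
Implicit Types st : state R.

Definition merge_pass_cost (n : nat) : nat :=
  scost merge_init + ((n * (scost merge_setup + scost merge_move + 13) + 10) +
    (n * (scost merge_copy + 13) + 10)).

(** All cursors start at 0, so the first step opens the first pair of blocks. *)
Lemma merge_pass_prog_spec st n w : (0 < w)%N -> imem st 0 0 = n -> imem st 5 0 = w ->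
  runs merge_pass_prog st (merge_pass_cost n) (fun st' =>
    slice (imem st' 1) 0 n = merge_pass (st_prec st) w (slice (imem st 1) 0 n)).
Proof.
move=> w0 stn stw; set A := imem st 1; set rm := rmem st.
pose le := st_prec (State (fun _ _ => 0%N) rm).
apply: runs_seq.
  apply: (@runs_straight _ _ _
    (fun st' => imem st' 0 0 = n /\ merging w n A rm 0 (with_counter 6 0 st'))) => //.
  split=> //; split=> //=; rewrite /upd /=.
  by rewrite !(slice_nil _ (leqnn 0)).
move=> st1 [st1n inv0]; apply: runs_seq.
  apply: runs_framed.
  apply: (@runs_for_items _ 6 _ _ n _ (merging w n A rm)) => //.
  move=> m st2 mn st2m st2n inv.
  apply: runs_seq; first exact: runs_framed (merge_setup_spec w0 mn st2m st2n inv).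
  move=> st3 [[inv3 mj] [fi _]].
  by apply: merge_move_spec mj inv3; rewrite // fi.
move=> st2 [inv2 [fi _]].
have st2n : imem st2 0 0 = n by rewrite fi.
have st2B : slice (imem st2 2) 0 n = merge_pass le w (slice A 0 n).
  case: inv2 => _ _ _ cnt en <-.
  rewrite (_ : imem st2 10 0 = n); last by lia.
  rewrite (slice_nil _ (leqnn n)) (slice_nil _ (_ : imem st2 9 0 <= imem st2 7 0)%N); last by lia.
  by rewrite (slice_nil _ (_ : n <= imem st2 8 0)%N) /= ?cats0//; lia.
rewrite -/rm in st2B *.
pose Inv m (st' : state R) :=
  imem st' 2 = imem st2 2 /\ slice (imem st' 1) 0 m = slice (imem st2 2) 0 m.
apply: (@runs_weaken _ _ _ _ _ (Inv n)); last by move=> st3 [_ ->].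
  apply: (@runs_for_items _ 6 _ _ n _ Inv) => //; first by split; rewrite ?(slice_nil _ (leqnn 0)).
  move=> m st3 mn st3m st3n [BE AE]; apply: runs_straight => //=.
  split=> //=; rewrite /upd /= !st3m; apply/esym.
  by rewrite slice_upd// AE BE slice_rcons.
by [].
Qed.

End MergeSortProg.

(** * Evaluating one candidate *)

Definition sort_init : cmd := IStore 1 (ivar 6) (ivar 6).
Definition double_width : cmd := iset 5 (IAdd (ivar 5) (ivar 5)).
Definition sort_prog : cmd :=
  Seq (for_items 6 sort_init)
    (Seq (iset 5 (IConst 1))
       (While (ilt (ivar 5) (ivar 0)) (Seq merge_pass_prog double_width))).

Definition sort_cost (n : nat) : nat :=
  (n * (scost sort_init + 13) + 10) + (scost (iset 5 (IConst 1)) +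
   (up_log 2 n * (bcost (ilt (ivar 5) (ivar 0)) + (merge_pass_cost n + scost double_width)).+1 +
     (bcost (ilt (ivar 5) (ivar 0))).+1)).

Definition current : iexp := ILoad 1 (ivar 6).
Definition current_var : rexp := RMul (RLoad 2 current) (RLoad 2 current).
Definition rcap : rexp := RLoad 3 (IConst 0).
Definition rquant : rexp := RLoad 3 (IConst 1).

Definition scan_init : cmd :=
  Seq (iset 6 (IConst 0)) (Seq (rset 7 (RConst 0)) (Seq (rset 8 (RConst 0)) (rset 9 (RConst 0)))).
Definition scan_cond : bexp :=
  rlt (RAdd (RAdd (rvar 7) (RLoad 1 current))
            (RMul rquant (RSqrt (RAdd (rvar 8) current_var)))) rcap.
Definition scan_step : cmd :=
  Seq (rset 7 (RAdd (rvar 7) (RLoad 1 current)))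
 (Seq (rset 8 (RAdd (rvar 8) current_var))
 (Seq (rset 9 (RAdd (rvar 9) (RLoad 0 current)))
      (iset 6 (IAdd (ivar 6) (IConst 1))))).

Definition rroot (q a s B S : rexp) : rexp :=
  let P := RAdd (RMul (RMul (RConst 2) B) a) (RMul (RMul q q) s) in
  RDiv (RSub P (RSqrt (RSub (RMul P P) (RMul (RMul (RConst 4) (RMul a a))
     (RSub (RMul B B) (RMul (RMul q q) S))))))
   (RMul (RConst 2) (RMul a a)).

Definition scan_value : cmd :=
  rset 10 (RAdd (rvar 9) (RMul (RLoad 0 current)
    (rroot rquant (RLoad 1 current) current_var (RSub rcap (rvar 7)) (rvar 8)))).

Definition evaluate : cmd :=
  Seq sort_prog (Seq scan_init (Seq (While scan_cond scan_step) scan_value)).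

Definition evaluate_cost (n : nat) : nat :=
  sort_cost n + (scost scan_init +
    ((n * (bcost scan_cond + scost scan_step).+1 + (bcost scan_cond).+1) + scost scan_value)).

Section Evaluate.
Variable R : realType.
Implicit Types st : state R.

(** After r rounds the blocks of width 2^r are sorted, so [up_log 2 n] rounds
suffice; a sorted permutation is unique because the order is total and
antisymmetric. *)
Lemma sort_prog_spec st n : imem st 0 0 = n ->
  runs sort_prog st (sort_cost n) (fun st' =>
    slice (imem st' 1) 0 n = sort (st_prec st) (iota 0 n)).
Proof.
move=> stn; set le := st_prec st.
have le_total : total le by exact: prec_total.
have le_trans : transitive le by exact: prec_trans.
have le_anti : antisymmetric le by exact: prec_anti.
apply: runs_seq.
  apply: runs_framed.
  apply: (@runs_for_items _ 6 _ _ n _ (fun m st' => slice (imem st' 1) 0 m = iota 0 m)) => //.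
    exact: slice_nil.
  move=> m st' mn st'm st'n inv.
  rewrite (_ : iota 0 m.+1 = rcons (iota 0 m) m); last by rewrite -addn1 iotaD cats1.
  by apply: runs_straight => //=; rewrite /upd /= !st'm slice_upd// inv.
move=> st1 [init [fi fr]].
pose Inv r st' := [/\ imem st' 0 0 = n, imem st' 5 0 = (2 ^ r)%N, st_prec st' = le,
  perm_eq (slice (imem st' 1) 0 n) (iota 0 n) & blocks_sorted le (2 ^ r) (slice (imem st' 1) 0 n)].
apply: runs_seq.
  apply: (@runs_straight _ _ _ (Inv 0%N)) => //; split=> //=.
  - by rewrite /upd /= fi.
  - by rewrite /st_prec /= !fr.
  - by rewrite /upd /= init.
  - by move=> k; case: (drop _ _) => //= x s; rewrite take0.
move=> st2 inv2.
apply: (@runs_weaken _ _ _ _ _ (Inv (up_log 2 n)) _ _ (leqnn _)); last first.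
  move=> st3 [_ _ _ pe bs].
  apply: (sorted_eq le_trans le_anti); last by rewrite perm_sym perm_sort perm_sym.
    have := bs 0%N; rewrite mul0n drop0 take_oversize//.
    by rewrite size_slice subn0 up_logP.
  exact: sort_sorted.
apply: (@runs_while _ (ilt (ivar 5) (ivar 0)) (Seq merge_pass_prog double_width)
  (merge_pass_cost n + scost double_width) (up_log 2 n) Inv) inv2
  => [r st3 rL [st3n st3w st3le pe bs]|st3 [st3n st3w _ _ _]].
  split; first by rewrite /= st3n st3w -ltnNge ltnNge; apply: contraL rL => /up_log_min; lia.
  apply: runs_seq.
    apply: runs_framed; apply: (merge_pass_prog_spec _ st3n st3w).
    by rewrite expn_gt0.
  move=> st4 [out [fi4 fr4]]; apply: runs_straight => //; rewrite /double_width /=.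
  split=> /=; rewrite /upd /=.
  - by rewrite fi4.
  - by rewrite fi4// st3w expnS mul2n addnn.
  - by rewrite -st3le /st_prec /= !fr4.
  - by rewrite out (perm_trans (merge_pass_perm _ _ _)) ?expn_gt0.
  - rewrite out expnS mul2n -addnn st3le; apply: merge_pass_sorted => //.
    by rewrite expn_gt0.
by rewrite /= st3n st3w negbK up_logP.
Qed.

Record loaded n (I : knapsack R n) st : Prop := Loaded {
  loaded_n : imem st 0 0 = n;
  loaded_c : rmem st 0 = vec (profit I);
  loaded_a : rmem st 1 = vec (weight I);
  loaded_s : rmem st 2 = vec (stdev I);
  loaded_b : rmem st 3 0 = capacity I;
  loaded_q : rmem st 3 1 = safety I }.

Lemma loaded_framed p n (I : knapsack R n) st st' :
  0%N \notin iwrites p -> all (fun k => k \notin rwrites p) [:: 0; 1; 2; 3]%N ->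
  framed p st st' -> loaded I st -> loaded I st'.
Proof.
move=> p0 /= /and5P[p1 p2 p3 p4 _] [fi fr] [ln lc la ls lb lq].
by split; rewrite ?fi ?fr.
Qed.

Lemma nth_slice (T : Type) (x0 : T) (A : nat -> T) n k : (k < n)%N ->
  nth x0 (slice A 0 n) k = A k.
Proof.
by move=> kn; rewrite sliceE (nth_map 0%N) ?size_iota ?subn0// nth_iota.
Qed.

(** The scan stops at the critical item, because the number [nb_full] of items
packed entirely is the first position at which the load reaches the capacity. *)
Lemma evaluate_spec n (I : knapsack R n) st d :
  well_posed I -> loaded I st -> rmem st 5 0 = d -> 0 <= d ->
  runs evaluate st (evaluate_cost n) (fun st' => rmem st' 10 0 = ncr_value I d).
Proof.
move=> wp ld std d0.
have sortE : st_prec st = item_order I d.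
  by case: ld => ln lc la ls lb lq; rewrite /st_prec lc la ls lq std.
apply: runs_seq; first exact: runs_framed (sort_prog_spec (loaded_n ld)).
rewrite sortE -/(sorted_items I d) => st1 [order fr1].
have {}ld : loaded I st1 by apply: loaded_framed fr1 ld.
have cm := nb_full_critical wp d0; rewrite (ncr_valueE wp d0 cm).
move: cm order; set m := nb_full I d; set o := sorted_items I d => -[mn bm mb] order.
set A := imem st1 1 in order.
have nthA k : (k < n)%N -> A k = nth 0%N o k by move=> kn; rewrite -order nth_slice.
have takeS k : (k < n)%N -> take k.+1 o = rcons (take k o) (A k).
  by move=> kn; rewrite (take_nth 0%N) ?nthA// -order size_slice subn0.
pose acc (f : nat -> R) k := \sum_(j <- take k o) f j.
have accS f k : (k < n)%N -> acc f k.+1 = acc f k + f (A k).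
  by move=> kn; rewrite /acc takeS// big_rcons.
pose sq j := vec (stdev I) j ^+ 2.
have acc0 f : acc f 0%N = 0 by rewrite /acc take0 big_nil.
pose Inv k st' := [/\ loaded I st' /\ imem st' 1 = A, imem st' 6 0 = k,
  rmem st' 7 0 = acc (vec (weight I)) k, rmem st' 8 0 = acc sq k &
  rmem st' 9 0 = acc (vec (profit I)) k].
have condE k st' : (k < n)%N -> Inv k st' ->
    beval st' scan_cond = (nload I (take k.+1 o) < capacity I).
  move=> kn [[[ln lc la ls lb lq] stA] stk s7 s8 s9].
  rewrite /scan_cond /rlt /= -ltNge s7 s8 la ls lb lq stA stk.
  by rewrite /nload -/(acc _ k.+1) -/(acc sq k.+1) !accS.
apply: runs_seq.
  apply: (@runs_straight _ _ _ (Inv 0%N)) => //; split; rewrite ?acc0//; split=> //.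
  by case: ld => *; split.
move=> st2 inv2; apply: runs_seq.
  apply: (@runs_weaken _ _ _
    (m * (bcost scan_cond + scost scan_step).+1 + (bcost scan_cond).+1)%N _ (Inv m) (Inv m));
    [|by rewrite leq_add2r leq_mul2r (ltnW mn) orbT|by move=> st3; exact].
  apply: (@runs_while _ scan_cond scan_step (scost scan_step) m Inv) inv2
    => [k st3 km inv3|st3 inv3].
    have kn := ltn_trans km mn.
    split; first by rewrite (condE k)// mb.
    apply: runs_straight => //.
    case: inv3 => -[[ln lc la ls lb lq] stA] stk s7 s8 s9.
    split; rewrite /= /upd /= ?stA ?stk ?addn1 ?s7 ?s8 ?s9 ?la ?ls ?lc ?accS//.
  by rewrite (condE m)// -leNgt.
move=> st3 [[[ln lc la ls lb lq] stA] stk s7 s8 s9].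
apply: runs_straight => //=; rewrite /upd /= stA stk s7 s8 s9 lc la ls lb lq.
by rewrite /greedy_value -nthA.
Qed.

End Evaluate.

(** * Searching all candidates *)

Definition rsq e : rexp := RMul e e.

Definition rswap : rexp :=
  let i := ivar 3 in let j := ivar 4 in
  rsq (RDiv (RMul rquant (RSub (RMul (RLoad 0 j) (rsq (RLoad 2 i)))
                               (RMul (RLoad 0 i) (rsq (RLoad 2 j)))))
            (RMul (RConst 2) (RSub (RMul (RLoad 0 i) (RLoad 1 j))
                                   (RMul (RLoad 0 j) (RLoad 1 i))))).

Definition record_point : cmd :=
  Seq (RStore 4 (IConst 0) (rvar 5)) (RStore 4 (IConst 1) (rvar 10)).
Definition update : cmd := If (BLer (RLoad 4 (IConst 1)) (rvar 10)) record_point Skip.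

(** Besides computing the swap point, this lowers the bound in real array 6 when
the point is positive and smaller. *)
Definition next_candidate : cmd :=
  Seq (rset 5 rswap)
      (If (BAnd (rlt (RConst 0) (rvar 5)) (BLer (rvar 5) (rvar 6))) (rset 6 (rvar 5)) Skip).

Definition try_pair : cmd := Seq next_candidate (Seq evaluate update).

Definition start : cmd := Seq record_point (rset 6 (RConst 1)).

Definition search : cmd :=
  Seq (rset 5 (RConst 0)) (Seq evaluate (Seq start
    (Seq (for_items 3 (for_items 4 try_pair))
      (Seq (rset 5 (RDiv (rvar 6) (RConst 2))) (Seq evaluate update))))).

Definition search_cost (n : nat) : nat :=
  scost (rset 5 (RConst 0)) + (evaluate_cost n + (scost start +
    ((n * (n * (scost next_candidate + (evaluate_cost n + scost update) + 13) + 10 + 13) + 10) +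
      (scost (rset 5 (RDiv (rvar 6) (RConst 2))) + (evaluate_cost n + scost update))))).

Section Search.
Variables (R : realType) (n : nat) (I : knapsack R n) (v : R -> R).
Implicit Types st : state R.
(** All that the search asks of the objective v is that [evaluate] computes it. *)
Hypothesis evaluate_v : forall st d, loaded I st -> rmem st 5 0 = d -> 0 <= d ->
  runs evaluate st (evaluate_cost n) (fun st' => rmem st' 10 0 = v d).

(** The state of the search once the pairs in [tested] have been tried. *)
Record searched (tested : nat -> nat -> Prop) st : Prop := Searched {
  searched_loaded : loaded I st;
  searched_ge0 : 0 <= rmem st 4 0;
  searched_val : rmem st 4 1 = v (rmem st 4 0);
  searched_0 : v 0 <= rmem st 4 1;
  searched_low : 0 < rmem st 6 0;
  searched_pairs : forall i j, tested i j ->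
    v (candidate I i j) <= rmem st 4 1 /\
    (0 < candidate I i j -> rmem st 6 0 <= candidate I i j) }.

Lemma searched_sub (P Q : nat -> nat -> Prop) st :
  (forall i j, Q i j -> P i j) -> searched P st -> searched Q st.
Proof. by move=> QP [? ? ? ? ? t]; split=> // i j /QP/t. Qed.

Lemma searched_counter P k m st : k != 0%N -> searched P st -> searched P (with_counter k m st).
Proof.
move=> k0 [[? ? ? ? ? ?] ? ? ? ? ?]; split=> //; split=> //=.
by rewrite /upd eq_sym (negbTE k0).
Qed.

(** The conclusion keeps the least positive candidate, on which the last point
to be tried depends. *)
Lemma evaluate_update_spec P st d : searched P st -> rmem st 5 0 = d -> 0 <= d ->
  runs (Seq evaluate update) st (evaluate_cost n + scost update)
    (fun st' => [/\ searched P st', v d <= rmem st' 4 1 & rmem st' 6 0 = rmem st 6 0]).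
Proof.
move=> [ld p0 pv v0 m0 tst] std d0; apply: runs_seq.
  exact: runs_framed (evaluate_v ld std d0).
move=> st1 [val fr1]; have ld1 : loaded I st1 by apply: loaded_framed fr1 ld.
case: fr1 => fi fr.
have r4 : rmem st1 4 = rmem st 4 by apply: fr.
have r5 : rmem st1 5 = rmem st 5 by apply: fr.
have r6 : rmem st1 6 = rmem st 6 by apply: fr.
apply: runs_straight => //; rewrite [denote _ _]/= r4 val.
have ld2 : loaded I (denote record_point st1) by case: ld1.
case: ifPn => [le|]; last first.
  rewrite -ltNge => lt; split; [split|rewrite r4; exact: ltW|by rewrite r6];
    rewrite ?r4 ?r6//.
split; last by rewrite /= /upd /= r6.
  split=> //=; rewrite /upd /= ?r5 ?std ?val ?r6//; first exact: le_trans le.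
  by move=> i j /tst[t1 t2]; split=> //; exact: le_trans le.
by rewrite /= /upd /= val.
Qed.

(** The pairs already tried when the nested loops reach (i0, j0). *)
Definition tested_before (i0 j0 i j : nat) : Prop :=
  ((i < i0) && (j < n) || (i == i0) && (j < j0))%N.

Lemma try_pair_spec st i j : imem st 3 0 = i -> imem st 4 0 = j ->
  searched (tested_before i j) st ->
  runs try_pair st (scost next_candidate + (evaluate_cost n + scost update))
    (fun st' => searched (tested_before i j.+1) st').
Proof.
move=> sti stj [ld p0 pv v0 m0 tst].
set c := candidate I i j.
pose Q st' := [/\ searched (tested_before i j) st', rmem st' 5 0 = c &
  0 < c -> rmem st' 6 0 <= c].
apply: (@runs_seq _ _ _ _ _ _ Q).
  apply: runs_straight => //; rewrite /next_candidate.
  pose st1 := denote (rset 5 rswap) st.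
  rewrite -[denote _ _]/(if beval st1 (BAnd (rlt (RConst 0) (rvar 5)) (BLer (rvar 5) (rvar 6)))
    then denote (rset 6 (rvar 5)) st1 else st1).
  have std : rmem st1 5 0 = c.
    by case: ld => ln lc la ls lb lq; rewrite /= sti stj lc la ls lq.
  have r4 : rmem st1 4 = rmem st 4 by apply: upd_other.
  have r6 : rmem st1 6 = rmem st 6 by apply: upd_other.
  have ld1 : loaded I st1 by case: ld.
  have srch1 : searched (tested_before i j) st1 by split; rewrite ?r4 ?r6.
  clearbody st1; rewrite [beval _ _]/= std r6 -ltNge.
  have [/andP[c0 cm]|ncm] := boolP (_ && _); last first.
    split=> // c0; rewrite r6 ltW// ltNge.
    by move: ncm; rewrite c0.
  have s5 : rmem (denote (rset 6 (rvar 5)) st1) 5 0 = c by [].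
  have s6 : rmem (denote (rset 6 (rvar 5)) st1) 6 0 = c by rewrite /= /upd /= std.
  have s4 : rmem (denote (rset 6 (rvar 5)) st1) 4 = rmem st 4 by rewrite /= upd_other.
  have ld2 : loaded I (denote (rset 6 (rvar 5)) st1) by case: ld1.
  split; rewrite ?s6//; split; rewrite ?s4 ?s6// => k l kl.
  have [t1 t2] := tst _ _ kl; split=> // ckl.
  exact: le_trans (t2 ckl).
move=> st1 [srch1 std low].
apply: runs_weaken (evaluate_update_spec srch1 std (candidate_ge0 _ _ _)) (leqnn _) _.
move=> st2 [srch2 vc low2].
case: srch2 => ld2 p2 pv2 v02 m2 tst2; split=> // k l kl.
have [/tst2//|[-> ->]] : tested_before i j k l \/ (k = i /\ l = j).
  by move: kl; rewrite /tested_before; lia.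
by rewrite low2.
Qed.

Lemma search_spec : (0 < n)%N -> well_posed I ->
  forall st, loaded I st -> runs search st (search_cost n) (fun st' =>
    [/\ 0 <= rmem st' 4 0, rmem st' 4 1 = v (rmem st' 4 0), v 0 <= rmem st' 4 1 &
      exists2 m, 0 < m & v (m / 2) <= rmem st' 4 1 /\
      (forall i j, (i < n)%N -> (j < n)%N -> v (candidate I i j) <= rmem st' 4 1 /\
        (0 < candidate I i j -> m <= candidate I i j))]).
Proof.
move=> n0 wp st ld.
apply: (@runs_seq _ _ _ _ _ _ (fun st' => loaded I st' /\ rmem st' 5 0 = 0)).
  by apply: runs_straight => //; split=> //; case: ld.
move=> st1 [ld1 std1]; apply: runs_seq.
  exact: runs_framed (evaluate_v ld1 std1 (lexx 0)).
move=> st2 [val fr2]; have ld2 : loaded I st2 by apply: loaded_framed fr2 ld1.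
have std2 : rmem st2 5 0 = 0 by case: fr2 => _ ->.
apply: (@runs_seq _ _ _ _ _ _ (searched (tested_before 0 0))).
  apply: runs_straight => //; split; rewrite /= /upd /= ?val ?std2//; first by case: ld2.
  by move=> i j; rewrite /tested_before; lia.
move=> st3 srch3; apply: (@runs_seq _ _ _ _ _ _ (searched (tested_before n 0))).
  apply: (@runs_for_items _ 3 _ _ n _ (fun m => searched (tested_before m 0))) => //.
  - exact: loaded_n (searched_loaded srch3).
  - exact: searched_counter.
  move=> i st4 lin st4i st4n srch4.
  pose Inv j st' := imem st' 3 0 = i /\ searched (tested_before i j) st'.
  apply: (@runs_weaken _ _ _ _ _ (Inv n) _ _ (leqnn _)); last first.
    move=> st5 [_ srch5]; apply: searched_counter => //.
    by apply: searched_sub srch5 => k l; rewrite /tested_before; lia.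
  apply: (@runs_for_items _ 4 _ _ n _ Inv) => //.
    by split=> //; exact: searched_counter.
  move=> j st5 ljn st5j st5n [st5i srch5].
  apply: runs_weaken (runs_framed (try_pair_spec st5i st5j srch5)) (leqnn _) _.
  move=> st6 [srch6 [fi _]]; split; last exact: searched_counter.
  by rewrite /= /upd /= fi.
move=> st4 srch4; set m := rmem st4 6 0.
have m0 : 0 < m by case: srch4.
apply: (@runs_seq _ _ _ _ _ _ (fun st' => searched (tested_before n 0) st' /\
    rmem st' 5 0 = m / 2 /\ rmem st' 6 0 = m)).
  by apply: runs_straight => //; split=> //; case: srch4 => -[? ? ? ? ? ?] ? ? ? ? ?; split.
move=> st5 [srch5 [std5 low5]].
apply: runs_weaken (evaluate_update_spec srch5 std5 _) (leqnn _) _; first by rewrite divr_ge0// ltW.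
move=> st6 [[ld6 p6 pv6 v06 m6 tst6] vm low6]; split=> //.
exists m => //; split=> // i j lin ljn; rewrite -low5 -low6.
by apply: tst6; rewrite /tested_before lin ljn.
Qed.

End Search.

(** * The running time is O(n^3 log n) *)

Section Dominated.
Local Open Scope nat_scope.

(** Big-O on n >= 2, where log n is positive and can absorb constants. *)
Definition dominated (f g : nat -> nat) : Prop :=
  exists K, forall n, 1 < n -> f n <= K * g n.

Lemma dominated_refl f : dominated f f.
Proof. by exists 1 => n _; rewrite mul1n. Qed.

Lemma dominated_const c g : (forall n, 1 < n -> 0 < g n) -> dominated (fun=> c) g.
Proof. by move=> g0; exists c => n n1; rewrite leq_pmulr// g0. Qed.

Lemma dominated_add f1 f2 g : dominated f1 g -> dominated f2 g ->
  dominated (fun n => f1 n + f2 n) g.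
Proof.
move=> [K1 b1] [K2 b2]; exists (K1 + K2) => n n1.
by rewrite mulnDl leq_add ?b1 ?b2.
Qed.

Lemma dominated_mul f1 f2 g1 g2 : dominated f1 g1 -> dominated f2 g2 ->
  dominated (fun n => f1 n * f2 n) (fun n => g1 n * g2 n).
Proof.
move=> [K1 b1] [K2 b2]; exists (K1 * K2) => n n1.
by rewrite mulnACA leq_mul ?b1 ?b2.
Qed.

Lemma dominated_le f g h : (forall n, 1 < n -> g n <= h n) -> dominated f g -> dominated f h.
Proof.
move=> gh [K b]; exists K => n n1; apply: leq_trans (b n n1) _.
by rewrite leq_mul2l gh ?orbT.
Qed.

Lemma dominated_S f g : (forall n, 1 < n -> 0 < g n) -> dominated f g ->
  dominated (fun n => (f n).+1) g.
Proof.
move=> g0 fg; have [K b] := dominated_add (dominated_const 1 g0) fg.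
by exists K => n n1; rewrite -add1n b.
Qed.

Local Notation L := (up_log 2).

Lemma up_log_ge1 n : 1 < n -> 0 < L n. Proof. by move=> n1; rewrite up_log_gt0. Qed.

Lemma merge_pass_cost_linear : dominated merge_pass_cost id.
Proof.
have c0 c : dominated (fun=> c) id by apply: dominated_const => n; lia.
have lin c : dominated (fun n => n * (c + 13) + 10) id.
  apply: dominated_add => //; exists (c + 13) => n _; rewrite mulnC//.
by apply: dominated_add => //; apply: dominated_add; apply: lin.
Qed.

(** There are [up_log 2 n] merge passes of linear cost; the scan is linear. *)
Lemma evaluate_cost_dominated : dominated evaluate_cost (fun n => n * L n).
Proof.
have g0 n : 1 < n -> 0 < n * L n by move=> n1; rewrite muln_gt0 up_log_ge1// ltnW.
have c0 c := dominated_const c g0.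
have lin f : dominated f id -> dominated f (fun n => n * L n).
  by apply: dominated_le => n n1; rewrite leq_pmulr// up_log_ge1.
have nc c : dominated (fun n => n * c) (fun n => n * L n).
  by apply: lin; exists c => n _; rewrite mulnC.
have passes : dominated (fun n => L n * (bcost (ilt (ivar 5) (ivar 0)) +
    (merge_pass_cost n + scost double_width)).+1) (fun n => n * L n).
  apply: (@dominated_le _ (fun n => L n * id n)); first by move=> n _; rewrite mulnC.
  apply: dominated_mul; first exact: dominated_refl.
  have i0 n : 1 < n -> 0 < id n by move=> n1 /=; lia.
  apply: dominated_S => //; apply: dominated_add; first exact: dominated_const.
  by apply: dominated_add; [exact: merge_pass_cost_linear|exact: dominated_const].
by do 7!(apply: dominated_add => //).
Qed.

Lemma search_cost_dominated : dominated search_cost (fun n => n ^ 3 * L n).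
Proof.
have L0 n : 1 < n -> 0 < L n by exact: up_log_ge1.
have up k j : k <= j -> forall f, dominated f (fun n => n ^ k * L n) ->
    dominated f (fun n => n ^ j * L n).
  move=> kj f; apply: dominated_le => n n1.
  by rewrite leq_mul2r leq_pexp2l ?orbT// ltnW.
have c0 c k : dominated (fun=> c) (fun n => n ^ k * L n).
  by apply: dominated_const => n n1; rewrite muln_gt0 expn_gt0 L0// ltnW.
have times k f : dominated f (fun n => n ^ k * L n) ->
    dominated (fun n => n * f n) (fun n => n ^ k.+1 * L n).
  move=> fk; have [K b] := dominated_mul (dominated_refl id) fk.
  by exists K => n n1; rewrite expnS -mulnA b.
have ev : dominated evaluate_cost (fun n => n ^ 1 * L n) by exact: evaluate_cost_dominated.
have ev3 : dominated evaluate_cost (fun n => n ^ 3 * L n) by exact: up ev.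
have pairs : dominated (fun n => n * (n * (scost next_candidate +
    (evaluate_cost n + scost update) + 13) + 10 + 13)) (fun n => n ^ 3 * L n).
  apply: (times 2%N); do 2!(apply: dominated_add => //); apply: (times 1%N).
  by do 3!(apply: dominated_add => //).
by do 7!(apply: dominated_add => //).
Qed.

End Dominated.

(** The rounding up in [up_log] costs at most one, which log_2 n absorbs for
n >= 2: hence the factor 2. *)
Lemma up_log_le_ln (R : realType) n : (1 < n)%N ->
  (up_log 2 n)%:R <= 2 / ln 2 * ln n%:R :> R.
Proof.
move=> n1; have ln2 : 0 < ln 2 :> R by rewrite ln_gt0// ltr1n.
have le1 : ln 2 <= ln n%:R :> R by rewrite ler_ln ?posrE ?ltr0n ?ler_nat// ltnW.
have le2 : (up_log 2 n).-1%:R * ln 2 <= ln n%:R :> R.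
  rewrite mulr_natl -lnXn// ler_ln ?posrE ?exprn_gt0 ?ltr0n ?(ltnW n1)//.
  by rewrite -natrX ler_nat ltnW// up_log_gtn.
rewrite mulrAC ler_pdivlMr// -(prednK (up_log_ge1 n1)) -natr1 mulrDl mul1r.
by rewrite [leRHS]mulr_natl mulr2n lerD.
Qed.

(** For n = 0 nothing can exceed the capacity, and a single item fits by
assumption. *)
Lemma well_posed_size (R : realType) n (I : knapsack R n) : well_posed I -> (1 < n)%N.
Proof.
have e0 : enum 'I_0 = [::] by apply: size0nil; rewrite size_enum_ord.
case: n I => [|[|//]] I [[_ _ s0] [b0 _]]; rewrite /load.
  by rewrite e0 !big_nil sqrtr0 mulr0 addr0 ltNge ltW.
rewrite enum_ordSl e0 !big_seq1 sqrtr_sqr ger0_norm// => lt /(_ ord0).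
by rewrite leNgt lt.
Qed.

Theorem theorem3 (R : realType) :
  exists (p : cmd) (C : R),
    forall (n : nat) (I : knapsack R n), well_posed I ->
      exists (st : state R) (t : nat),
        [/\ exec p (input_state I) st t,
            t%:R <= C * (n%:R ^+ 3 * ln (n%:R)),
            ncr_optimal I (out_point st) &
            out_value st = ncr_value I (out_point st)].
Proof.
have [K costK] := search_cost_dominated.
exists search, (K%:R * (2 / ln 2)) => n I wp; have n1 := well_posed_size wp.
have ld : loaded I (input_state I) by split.
have [st [t [run tT [p0 pv v0 [m m0 [vm pairs]]]]]] :=
  search_spec (fun st d => @evaluate_spec R n I st d wp) (ltnW n1) wp ld.
rewrite pv in pairs v0 vm.
exists st, t; split; [exact: run| |exact: (candidates_optimal wp p0 m0 pairs v0 vm)|exact: pv].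
have : (t <= K * (n ^ 3 * up_log 2 n))%N by exact: leq_trans (costK n n1).
rewrite -(ler_nat R) natrM (natrM _ (n ^ 3)%N) natrX => /le_trans; apply.
rewrite -[leRHS]mulrA; apply: ler_wpM2l => //; rewrite [leRHS]mulrCA.
by apply: ler_wpM2l; [exact: exprn_ge0|exact: up_log_le_ln].
Qed.
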